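(* Let $p,q\in\mathbb{C}^{2n}$ be linearly independent, let $\alpha,\beta\in\{1,\dots,n\}$, and let $P,Q:\mathbf{Sp}(n)\to\mathbb{C}$ be the complex-valued functions $$P(z,w)=\sum_{j=1}^n(p_j z_{j\alpha}+p_{n+j}w_{j\alpha}),\qquad Q(z,w)=\sum_{k=1}^n(q_k z_{k\beta}+q_{n+k}w_{k\beta}).$$ Let the rational function $f(z,w)=P(z,w)/Q(z,w)$ be defined on the open and dense subset $W_Q=\{z+jw\in\mathbf{Sp}(n)\mid Q(z,w)\neq 0\}$ of $\mathbf{Sp}(n)$. (a) The function $f$ is harmonic if and only if $\alpha=\beta$. (b) The function $f$ is proper biharmonic if and only if $\alpha\neq\beta$.
   Context: The quaternionic unitary group $\mathbf{Sp}(n)$ is the intersection of $\mathbf{U}(2n)$ with the image of the standard representation of $\mathbf{GL}_n(\mathbb{H})$ in $\mathbb{C}^{2n\times 2n}$, $$z+jw\mapsto\begin{bmatrix}z&w\\-\bar w&\bar z\end{bmatrix},\qquad z,w\in\mathbb{C}^{n\times n}.$$ For $1\le j,\alpha\le n$, $z_{j\alpha}$ and $w_{j\alpha}$ denote the $(j,\alpha)$-entries (row $j$, column $\alpha$) of the blocks $z$ and $w$. The group carries the biinvariant Riemannian metric induced by the scalar product $g(Z,W)=\mathrm{Re}\,\mathrm{trace}(ZW^* )$ on its Lie algebra $\mathfrak{sp}(n)\subset\mathbb{C}^{2n\times 2n}$. For a complex-valued function $f$ on an open subset of a Riemannian manifold, $\tau(f)=\mathrm{div}(\nabla f)$ is the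 Laplace-Beltrami operator (extended complex-linearly) and $\tau^2(f)=\tau(\tau(f))$. The function $f$ is harmonic if $\tau(f)=0$; it is proper biharmonic if $\tau^2(f)=0$ and $\tau(f)$ does not vanish identically.
   Formalization: The displayed representation of z+jw is corrected to the multiplicative one, with blocks z, -conj(w) above w, conj(z), so w is the lower-left block; with w as the upper-right block (a) fails for n≥2, e.g. f = z_{1α}/w_{2α}. *)

(* Defs.v *)
From HB Require Import structures.
From mathcomp Require Import all_boot all_order all_algebra.
From mathcomp Require Import complex.
From mathcomp Require Import all_classical all_reals all_analysis.
Set Implicit Arguments.
Unset Strict Implicit.
Unset Printing Implicit Defensive.
Import Order.TTheory GRing.Theory Num.Theory.
Import numFieldNormedType.Exports.
Local Open Scope classical_set_scope.
Local Open Scope ring_scope.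
Local Open Scope complex_scope.
Local Open Scope sesquilinear_scope.

Section QuaternionicUnitaryGroup.
Context {R : realType} {n : nat}.
Local Notation C := (R[i]).
Local Notation M := 'M[C]_(n + n).

Definition conjm (a : 'M[C]_n) : 'M[C]_n := map_mx Num.conj a.

(* Since j a = (conj a) j, the quaternionic product of z + j w and z' + j w' is
     (z z' - (conj w) w') + j (w z' + (conj z) w'),
   and the matrix that represents z + j w multiplicatively (quat_repM) has w in
   the lower left block.  The frequently displayed form
   [[z, w], [- conj w, conj z]] represents z + w j instead.  Both parametrise
   the same set of matrices (quat_rep_image), hence the same group Sp(n), but
   the coordinate function w differs; matrix coefficients such as
   sum_j (p_j z_{j a} + p_{n+j} w_{j a}), which run down one column of the
   2n-dimensional representation, belong to z + j w. *)
Definition quat_rep (z w : 'M[C]_n) : M :=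
  block_mx z (- conjm w) w (conjm z).

Lemma conjmM (a b : 'M[C]_n) : conjm (a *m b) = conjm a *m conjm b.
Proof. by rewrite /conjm map_mxM. Qed.

Lemma conjmD (a b : 'M[C]_n) : conjm (a + b) = conjm a + conjm b.
Proof. by rewrite /conjm map_mxD. Qed.

Lemma conjmN (a : 'M[C]_n) : conjm (- a) = - conjm a.
Proof. by rewrite /conjm map_mxN. Qed.

Lemma conjmK : involutive conjm.
Proof. by move=> a; apply/matrixP => i j; rewrite !mxE conjCK. Qed.

Lemma quat_repM (z w z' w' : 'M[C]_n) :
  quat_rep z w *m quat_rep z' w' =
  quat_rep (z *m z' - conjm w *m w') (w *m z' + conjm z *m w').
Proof.
rewrite /quat_rep mulmx_block !conjmD !conjmN !conjmM !conjmK !mulNmx !mulmxN.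
by congr block_mx; rewrite 1?opprD addrC.
Qed.

Lemma quat_rep_image (X : M) :
  (exists z w, X = quat_rep z w) <->
  (exists z w, X = block_mx z w (- conjm w) (conjm z)).
Proof.
split=> -[z [w ->]]; exists z; exists (- conjm w);
  by rewrite /quat_rep conjmN conjmK ?opprK.
Qed.

(* Invertibility of z + j w is implied by unitarity. *)
Definition Sp : set M :=
  [set X | X \is unitarymx /\ exists z w, X = quat_rep z w].

Definition z_ (X : M) : 'M[C]_n := ulsubmx X.
Definition w_ (X : M) : 'M[C]_n := dlsubmx X.

(* g Z W = Re trace (Z W^* ) *)
Definition g (Z W : M) : R := complex.Re (\tr (Z *m W^t*)).

Definition curve_through (X V : M) (c : R -> M) : Prop :=
  [/\ forall t, Sp (c t), c 0 = X &
      forall i j,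
        is_derive (0 : R) (1 : R) (fun t => complex.Re (c t i j))
          (complex.Re (V i j)) /\
        is_derive (0 : R) (1 : R) (fun t => complex.Im (c t i j))
          (complex.Im (V i j))].

Definition tangent (X : M) : set M :=
  [set V | exists c, curve_through X V c].

Definition metric (X V W : M) : R := g (invmx X *m V) (invmx X *m W).

(* Functions on open subsets of Sp(n) are total functions on matrices; the
   operators below only depend on their germs along Sp(n). *)
Definition differential (u : M -> R) (X V : M) : R :=
  xget 0 [set d | forall c, curve_through X V c ->
                    is_derive (0 : R) (1 : R) (fun t => u (c t)) d].

Definition gradient (u : M -> R) (X : M) : M :=
  xget 0 [set V | tangent X V /\
                  forall U, tangent X U -> metric X V U = differential u X U].

Definition ambient_derivative (V : M -> M) (X U : M) : M :=
  \matrix_(i, j) (differential (fun Y => complex.Re (V Y i j)) X U +i*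
                  differential (fun Y => complex.Im (V Y i j)) X U).

Definition tangential_part (X Z : M) : M :=
  xget 0 [set V | tangent X V /\ forall U, tangent X U -> g (Z - V) U = 0].

Lemma metricE (X V W : M) : X \is unitarymx -> metric X V W = g V W.
Proof.
move=> uX; have XK : X *m X ^t* = 1%:M by apply/eqP.
have uXX := mulmx1_unit XK; have iX : invmx X = X ^t*.
  by rewrite -[LHS]mulmx1 -XK mulKmx ?uXX.1.
rewrite /metric /g iX trmx_mul map_mxM /= -mulmxA mxtrace_mulC -!mulmxA.
have -> : (X ^t*)^T ^ Num.conj = X by apply/matrixP => i j; rewrite !mxE conjCK.
by rewrite XK mulmx1.
Qed.

(* The metric on Sp(n) is the restriction of the Euclidean scalar product g of
   the space of matrices (metricE), so the Levi-Civita connection is the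
   tangential part of the derivative in that space. *)
Definition levi_civita (V : M -> M) (X U : M) : M :=
  tangential_part X (ambient_derivative V X U).

Definition orthonormal_basis (X : M) (k : nat) (e : 'I_k -> M) : Prop :=
  [/\ forall i, tangent X (e i),
      forall i j, metric X (e i) (e j) = (i == j)%:R &
      forall U, tangent X U -> U = \sum_i (metric X U (e i))%:C *: e i].

(* The trace of U |-> levi_civita V X U on the tangent space at X. *)
Definition divergence (V : M -> M) (X : M) : R :=
  xget 0 [set d | forall k (e : 'I_k -> M), orthonormal_basis X e ->
                    d = \sum_i metric X (levi_civita V X (e i)) (e i)].

Definition laplacian (u : M -> R) (X : M) : R := divergence (gradient u) X.

Definition tau (f : M -> C) (X : M) : C :=
  laplacian (fun Y => complex.Re (f Y)) X +i*
  laplacian (fun Y => complex.Im (f Y)) X.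

Definition harmonic_on (W : set M) (f : M -> C) : Prop :=
  forall X, W X -> tau f X = 0.

Definition proper_biharmonic_on (W : set M) (f : M -> C) : Prop :=
  (forall X, W X -> tau (tau f) X = 0) /\ (exists X, W X /\ tau f X <> 0).

(* The entries p_j and p_{n+j} are those at lshift n j and rshift n j. *)
Definition column_form (p : 'cV[C]_(n + n)) (alpha : 'I_n) (X : M) : C :=
  \sum_(j < n) (p (lshift n j) 0 * z_ X j alpha +
                p (rshift n j) 0 * w_ X j alpha).

Definition nonvanishing (Q : M -> C) : set M := [set X | Sp X /\ Q X != 0].

End QuaternionicUnitaryGroup.

(* Main.v *)
Require Import Defs.
From mathcomp Require Import all_boot all_order all_algebra.
From mathcomp Require Import fingroup perm complex ring.
From mathcomp Require Import all_classical all_reals all_analysis.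
Import Order.TTheory GRing.Theory Num.Theory.
Import numFieldNormedType.Exports.
Set Implicit Arguments.
Unset Strict Implicit.
Unset Printing Implicit Defensive.
Local Open Scope classical_set_scope.
Local Open Scope ring_scope.
Local Open Scope complex_scope.
Local Open Scope sesquilinear_scope.

(** The metric is biinvariant, so the Laplace-Beltrami operator is the sum of
    the squares of the left-invariant fields X |-> X A_i, for any orthonormal
    basis (A_i) of the Lie algebra sp(n).  In terms of the complex fields
    X |-> X E_ab this is a contraction with the tensor
    sum_i (A_i)_ab (A_i)_cd, which is computed from the orthogonal projection
    onto sp(n) without any choice of basis ([casimirE]):

      sum_i (A_i)_ab (A_i)_cd = - 1/2 (delta_bc delta_ad + J_ca J_bd),

    with J the matrix of the quaternion j.  [tauE] passes from the
    definitions of gradient, connection and divergence to this contraction.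

    Let P_c(X) = (p^T X)_c and Q_c(X) = (q^T X)_c be the matrix coefficients
    at the column c, and let kappa be the complex-bilinear product of gradients.  All
    coefficients are eigenfunctions for one eigenvalue, and for columns a, b
    in the left half kappa(P_a, Q_b) = - 1/2 P_b Q_a, because J_ab = 0 there
    ([second_order_coef], [kappa_dcoef]).  The product and quotient rules for a
    second-order operator then give

      tau (P_a / Q_b) = P_b Q_a / Q_b^2 - P_a / Q_b,

    where the eigenvalue cancels, and a second application of the same rules to
    the right-hand side gives 0 ([tau_quotient], [tau_tau_quotient]).  So the
    quotient is always biharmonic, and it is harmonic when a = b.

    When a <> b it remains to find a group element at which Q_b and
    P_b Q_a - P_a Q_b do not vanish ([minor_nonvanishing]).  Some two by two
    minor of the rows p, q is nonzero; coordinate permutations, multiplication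
    of coordinates by j and one real reflection move it to the columns
    b and a. *)

(** * Derivatives of complex-valued curves *)

Section ComplexDerivative.
Context {R : realType}.
Local Notation C := (R[i]).
Implicit Types (h k : R -> C) (l m : C).

Definition cderiv h l : Prop :=
  is_derive (0 : R) (1 : R) (fun t => complex.Re (h t)) (complex.Re l) /\
  is_derive (0 : R) (1 : R) (fun t => complex.Im (h t)) (complex.Im l).

Lemma ReD (x y : C) : complex.Re (x + y) = complex.Re x + complex.Re y.
Proof. by case: x; case: y. Qed.
Lemma ImD (x y : C) : complex.Im (x + y) = complex.Im x + complex.Im y.
Proof. by case: x; case: y. Qed.
Lemma ReN (x : C) : complex.Re (- x) = - complex.Re x.
Proof. by case: x. Qed.
Lemma ImN (x : C) : complex.Im (- x) = - complex.Im x.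
Proof. by case: x. Qed.
Lemma ReM (x y : C) :
  complex.Re (x * y) = complex.Re x * complex.Re y - complex.Im x * complex.Im y.
Proof. by case: x; case: y. Qed.
Lemma ImM (x y : C) :
  complex.Im (x * y) = complex.Re x * complex.Im y + complex.Im x * complex.Re y.
Proof. by case: x; case: y. Qed.
Lemma ReJ (x : C) : complex.Re (Num.conj x) = complex.Re x.
Proof. by case: x. Qed.
Lemma ImJ (x : C) : complex.Im (Num.conj x) = - complex.Im x.
Proof. by case: x. Qed.

Lemma Re_sum (I : Type) (r : seq I) (F : I -> C) :
  complex.Re (\sum_(i <- r) F i) = \sum_(i <- r) complex.Re (F i).
Proof. by elim: r => [|i r IH]; rewrite ?big_nil // !big_cons ReD IH. Qed.

Lemma Cext (x y : C) :
  complex.Re x = complex.Re y -> complex.Im x = complex.Im y -> x = y.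
Proof. by case: x => a b; case: y => c d /= -> ->. Qed.

Lemma cderiv_uniq h l m : cderiv h l -> cderiv h m -> l = m.
Proof.
by case=> [rl il] [rm im]; apply: Cext;
  [rewrite -(derive_val (is_derive := rl)) (derive_val (is_derive := rm))
  |rewrite -(derive_val (is_derive := il)) (derive_val (is_derive := im))].
Qed.

Lemma cderiv_near h k l :
  (\forall t \near (0 : R), h t = k t) -> cderiv h l -> cderiv k l.
Proof.
move=> hk [r i]; split; [apply: near_eq_is_derive r|apply: near_eq_is_derive i];
  by near=> t; congr (_ _); near: t.
Unshelve. all: by end_near. Qed.

Lemma cderiv_cst a : cderiv (fun=> a) 0.
Proof. by split; exact: is_derive_cst. Qed.

Lemma cderiv_real (u : R -> R) (d : R) :
  is_derive (0 : R) (1 : R) u d -> cderiv (fun t => (u t)%:C) d%:C.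
Proof. by move=> ud; split => //=; exact: is_derive_cst. Qed.

Lemma cderivD h k l m :
  cderiv h l -> cderiv k m -> cderiv (fun t => h t + k t) (l + m).
Proof.
move=> [hr hi] [kr ki]; split.
  under eq_fun do rewrite ReD.
  by rewrite ReD; exact: is_deriveD.
under eq_fun do rewrite ImD.
by rewrite ImD; exact: is_deriveD.
Qed.

Lemma cderivN h l : cderiv h l -> cderiv (fun t => - h t) (- l).
Proof.
move=> [hr hi]; split.
  under eq_fun do rewrite ReN.
  by rewrite ReN; exact: is_deriveN.
under eq_fun do rewrite ImN.
by rewrite ImN; exact: is_deriveN.
Qed.

Lemma cderiv_conj h l :
  cderiv h l -> cderiv (fun t => Num.conj (h t)) (Num.conj l).
Proof.
move=> [hr hi]; split.
  under eq_fun do rewrite ReJ.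
  by rewrite ReJ.
under eq_fun do rewrite ImJ.
by rewrite ImJ; exact: is_deriveN.
Qed.

Lemma cderivM h k l m : cderiv h l -> cderiv k m ->
  cderiv (fun t => h t * k t) (l * k 0 + h 0 * m).
Proof.
move=> [hr hi] [kr ki]; split.
  under eq_fun do rewrite ReM.
  apply: (is_derive_eq (is_deriveB (is_deriveM hr kr) (is_deriveM hi ki))).
  by rewrite ReD !ReM /GRing.scale /=; ring.
under eq_fun do rewrite ImM.
apply: (is_derive_eq (is_deriveD (is_deriveM hr ki) (is_deriveM hi kr))).
by rewrite ImD !ImM /GRing.scale /=; ring.
Qed.

Lemma cderiv_sum (I : Type) (r : seq I) (h : I -> R -> C) (l : I -> C) :
  (forall i, cderiv (h i) (l i)) ->
  cderiv (fun t => \sum_(i <- r) h i t) (\sum_(i <- r) l i).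
Proof.
move=> hl; elim: r => [|i r IH].
  by under eq_fun do rewrite big_nil; rewrite big_nil; exact: cderiv_cst.
under eq_fun do rewrite big_cons.
by rewrite big_cons; apply: cderivD.
Qed.

Lemma is_derive_near_neq (u : R -> R) (d a : R) :
  is_derive (0 : R) (1 : R) u d -> u 0 != a -> \forall t \near (0 : R), u t != a.
Proof.
move=> [du _] u0.
have cu : {for (0 : R), continuous u}.
  exact/differentiable_continuous/derivable1_diffP.
have : nbhs (u 0) [set x | x != a].
  by apply: open_nbhs_nbhs; split => //; exact: open_neq.
by move=> /cu.
Qed.

(** A derivative makes the real and imaginary parts continuous, so that a
    denominator which does not vanish at 0 does not vanish nearby. *)
Lemma cderiv_near_neq0 h l :
  cderiv h l -> h 0 != 0 -> \forall t \near (0 : R), h t != 0.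
Proof.
move=> [hr hi]; rewrite eq_complex negb_and => /orP[] h0.
  have := is_derive_near_neq hr h0; apply: filterS => t.
  by apply: contraNneq => ->.
have := is_derive_near_neq hi h0; apply: filterS => t.
by apply: contraNneq => ->.
Qed.

Lemma cderivV h l : cderiv h l -> h 0 != 0 ->
  cderiv (fun t => (h t)^-1) (- l * (h 0)^-1 ^+ 2).
Proof.
move=> hl h0.
pose N t := h t * Num.conj (h t).
have nE t : N t = (complex.Re (h t) ^+ 2 + complex.Im (h t) ^+ 2)%:C.
  rewrite /N; apply: Cext; rewrite ?ReM ?ImM ReJ ImJ /=; ring.
have N0 : complex.Re (h 0) ^+ 2 + complex.Im (h 0) ^+ 2 != 0.
  move: h0; apply: contraNneq => e.
  have /eqP := nE 0; rewrite e /N mulf_eq0 conjC_eq0 orbb => /eqP -> //.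
case: (hl) => hr hi.
have dN : is_derive (0 : R) (1 : R)
    (fun t => (complex.Re (h t) ^+ 2 + complex.Im (h t) ^+ 2)^-1)
    (- (complex.Re (h 0) ^+ 2 + complex.Im (h 0) ^+ 2) ^- 2 *
     (2 * complex.Re (h 0) * complex.Re l + 2 * complex.Im (h 0) * complex.Im l)).
  apply: is_deriveV => //.
  apply: (is_derive_eq (is_deriveD (is_deriveX 2 hr) (is_deriveX 2 hi))).
  by rewrite /GRing.scale /= !expr1.
have VE t : (h t)^-1 =
    Num.conj (h t) * ((complex.Re (h t) ^+ 2 + complex.Im (h t) ^+ 2)^-1)%:C.
  have [->|ht] := eqVneq (h t) 0; first by rewrite invr0 conjC0 mul0r.
  apply: (mulfI ht); rewrite mulfV // mulrA -/(N t) nE -rmorphM mulfV //.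
  move: ht; apply: contraNneq => e.
  by have /eqP := nE t; rewrite e /N mulf_eq0 conjC_eq0 orbb.
have D := cderivM (cderiv_conj hl) (cderiv_real dN).
have -> : (fun t => (h t)^-1) = (fun t => Num.conj (h t) *
   ((complex.Re (h t) ^+ 2 + complex.Im (h t) ^+ 2)^-1)%:C) by apply/funext.
congr cderiv: D.
rewrite VE.
set a := complex.Re (h 0) in N0 *; set b := complex.Im (h 0) in N0 *.
have -> : h 0 = a +i* b by rewrite /a /b; case: (h 0).
have -> : l = complex.Re l +i* complex.Im l by case: (l).
by apply: Cext; rewrite !(ReD, ImD, ReN, ImN, ReM, ImM) /= ?expr2
  ?(ReM, ImM) /=; field; exact: N0.
Qed.

(** Only boundedness of the remainder is asked for: it is all that is known of
    a family of unitary matrices that is not yet known to be continuous. *)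
Lemma is_derive_quadratic (u r : R -> R) (d b : R) :
  (forall t, u t = u 0 + t * d + t ^+ 2 * r t) -> (forall t, `|r t| <= b) ->
  is_derive (0 : R) (1 : R) u d.
Proof.
move=> uE rb; apply/is_derive1_caratheodory.
exists (fun t => d + t * r t); split; [|  |by rewrite mul0r addr0].
  by move=> z; rewrite uE [u 0]uE; ring.
suff : (d + t * r t) @[t --> (0 : R)] --> d + 0 * r 0 by [].
rewrite mul0r; apply: cvgD; first exact: cvg_cst.
apply/norm_cvg0P.
apply: (@squeeze_cvgr _ _ _ _ (fun=> 0) (fun t : R => `|t| * b)).
- near=> t; rewrite normr_ge0 /= normrM ler_wpM2l //.
- exact: cvg_cst.
- rewrite -[X in _ --> X](mul0r b) -[X in X * _](@normr0 R R).
  apply: cvgM; last exact: cvg_cst.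
  by apply: cvg_norm.
Unshelve. all: by end_near. Qed.

Lemma cderiv_quadratic h (r : R -> C) l (b : R) :
  (forall t, h t = h 0 + t%:C * l + (t ^+ 2)%:C * r t) ->
  (forall t, `|complex.Re (r t)| <= b /\ `|complex.Im (r t)| <= b) ->
  cderiv h l.
Proof.
move=> hE rb; split.
  apply: (@is_derive_quadratic _ (fun t => complex.Re (r t)) _ b) => [t|t].
    by rewrite [in LHS]hE !(ReD, ReM) /=; ring.
  by case: (rb t).
apply: (@is_derive_quadratic _ (fun t => complex.Im (r t)) _ b) => [t|t].
  by rewrite [in LHS]hE !(ImD, ImM) /=; ring.
by case: (rb t).
Qed.

End ComplexDerivative.

(** * The group and its Lie algebra *)

Section Group.
Context {R : realType} {n : nat}.
Local Notation C := (R[i]).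
Local Notation M := 'M[C]_(n + n).
Local Notation cj := (map_mx Num.conj).
Implicit Types (X Y Z W A B : M).

Lemma conjmxM (p q r : nat) (A : 'M[C]_(p, q)) (B : 'M[C]_(q, r)) :
  cj (A *m B) = cj A *m cj B.
Proof. exact: map_mxM. Qed.

Lemma conjmxK (p q : nat) (A : 'M[C]_(p, q)) : cj (cj A) = A.
Proof. by apply/matrixP => i j; rewrite !mxE conjCK. Qed.

Lemma adjM (p q r : nat) (A : 'M[C]_(p, q)) (B : 'M[C]_(q, r)) :
  (A *m B)^t* = B^t* *m A^t*.
Proof. by rewrite trmx_mul conjmxM. Qed.

Lemma adjK (p q : nat) (A : 'M[C]_(p, q)) : (A^t*)^t* = A.
Proof. by apply/matrixP => i j; rewrite !mxE conjCK. Qed.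

Lemma adjD (p q : nat) (A B : 'M[C]_(p, q)) : (A + B)^t* = A^t* + B^t*.
Proof. by apply/matrixP => i j; rewrite !mxE rmorphD. Qed.

Lemma adjN (p q : nat) (A : 'M[C]_(p, q)) : (- A)^t* = - A^t*.
Proof. by apply/matrixP => i j; rewrite !mxE rmorphN. Qed.

Lemma adjZ (p q : nat) (a : C) (A : 'M[C]_(p, q)) :
  (a *: A)^t* = Num.conj a *: A^t*.
Proof. by apply/matrixP => i j; rewrite !mxE rmorphM. Qed.

Lemma adj1 (p : nat) : (1%:M : 'M[C]_p)^t* = 1%:M.
Proof. by rewrite trmx1 map_mx1. Qed.

Lemma conjmx1 (p : nat) : cj (1%:M : 'M[C]_p) = 1%:M.
Proof. exact: map_mx1. Qed.

Lemma conj_adj (p q : nat) (A : 'M[C]_(p, q)) : cj (A^t*) = (cj A)^t*.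
Proof. by rewrite map_trmx. Qed.

Lemma conjmxD (p q : nat) (A B : 'M[C]_(p, q)) : cj (A + B) = cj A + cj B.
Proof. exact: map_mxD. Qed.

Lemma conjmxN (p q : nat) (A : 'M[C]_(p, q)) : cj (- A) = - cj A.
Proof. exact: map_mxN. Qed.

Lemma conjmxZ (p q : nat) (a : C) (A : 'M[C]_(p, q)) :
  cj (a *: A) = Num.conj a *: cj A.
Proof. by apply/matrixP => i j; rewrite !mxE rmorphM. Qed.

Lemma mulmx_adj_eq0 (p q : nat) (A : 'M[C]_(p, q)) : A *m A^t* = 0 -> A = 0.
Proof.
move=> AA; apply/matrixP => i j; rewrite mxE.
have := congr1 (fun D : 'M[C]_p => D i i) AA; rewrite !mxE => /eqP.
rewrite psumr_eq0 => [/allP/(_ j (mem_index_enum _))|k _].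
  by rewrite !mxE mulf_eq0 conjC_eq0 orbb => /eqP.
by rewrite !mxE mul_conjC_ge0.
Qed.

(** ** The scalar product *)

Lemma gE Z W : g Z W = \sum_i \sum_j
  (complex.Re (Z i j) * complex.Re (W i j) +
   complex.Im (Z i j) * complex.Im (W i j)).
Proof.
rewrite /g /mxtrace Re_sum; apply: eq_bigr => i _.
rewrite mxE Re_sum; apply: eq_bigr => j _.
by rewrite !mxE ReM ReJ ImJ mulrN opprK.
Qed.

Lemma gC Z W : g Z W = g W Z.
Proof.
rewrite !gE; apply: eq_bigr => i _; apply: eq_bigr => j _.
by rewrite [complex.Re _ * _]mulrC [complex.Im _ * _]mulrC.
Qed.

Lemma gDl Y Z W : g (Y + Z) W = g Y W + g Z W.
Proof. by rewrite /g mulmxDl mxtraceD ReD. Qed.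

Lemma gNl Z W : g (- Z) W = - g Z W.
Proof. by rewrite /g mulNmx linearN ReN. Qed.

Lemma gZl (r : R) Z W : g (r%:C *: Z) W = r * g Z W.
Proof. by rewrite /g -scalemxAl mxtraceZ ReM /= mul0r subr0. Qed.

Lemma g0l W : g 0 W = 0.
Proof. by rewrite /g mul0mx mxtrace0. Qed.

Lemma g_suml (I : Type) (r : seq I) (F : I -> M) W :
  g (\sum_(i <- r) F i) W = \sum_(i <- r) g (F i) W.
Proof.
by elim: r => [|i r IH]; rewrite ?big_nil ?g0l // !big_cons gDl IH.
Qed.

Lemma gDr Y Z W : g W (Y + Z) = g W Y + g W Z.
Proof. by rewrite ![g W _]gC gDl. Qed.
Lemma gNr Z W : g W (- Z) = - g W Z.
Proof. by rewrite ![g W _]gC gNl. Qed.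
Lemma gZr (r : R) Z W : g W (r%:C *: Z) = r * g W Z.
Proof. by rewrite ![g W _]gC gZl. Qed.
Lemma g_sumr (I : Type) (r : seq I) (F : I -> M) W :
  g W (\sum_(i <- r) F i) = \sum_(i <- r) g W (F i).
Proof. by rewrite gC g_suml; apply: eq_bigr => i _; rewrite gC. Qed.

Lemma g_ge0 Z : 0 <= g Z Z.
Proof.
rewrite gE; apply: sumr_ge0 => i _; apply: sumr_ge0 => j _.
by rewrite -!expr2 addr_ge0 ?sqr_ge0.
Qed.

Lemma g_eq0 Z : g Z Z = 0 -> Z = 0.
Proof.
rewrite gE => /eqP; rewrite psumr_eq0 => [/allP Z0|i _]; last first.
  by apply: sumr_ge0 => j _; rewrite -!expr2 addr_ge0 ?sqr_ge0.
apply/matrixP => i j; rewrite mxE.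
have /= := Z0 i (mem_index_enum _).
rewrite psumr_eq0 => [/allP/(_ j (mem_index_enum _)) /=|k _]; last first.
  by rewrite -!expr2 addr_ge0 ?sqr_ge0.
rewrite -!expr2 paddr_eq0 ?sqr_ge0 // !sqrf_eq0 => /andP[/eqP r0 /eqP i0].
exact: Cext.
Qed.

Lemma g_adj Z W : g (Z^t*) (W^t*) = g Z W.
Proof.
rewrite !gE exchange_big; apply: eq_bigr => i _; apply: eq_bigr => j _.
by rewrite !mxE !ReJ !ImJ mulrNN.
Qed.

Lemma g_cj Z W : g (cj Z) (cj W) = g Z W.
Proof.
rewrite !gE; apply: eq_bigr => i _; apply: eq_bigr => j _.
by rewrite !mxE !ReJ !ImJ mulrNN.
Qed.

Lemma g_mulmxr Z W A : g (Z *m A) W = g Z (W *m A^t*).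
Proof. by rewrite /g adjM adjK mulmxA. Qed.

Lemma g_mulmxl Z W A : g (A *m Z) W = g Z (A^t* *m W).
Proof. by rewrite -g_adj adjM g_mulmxr adjK -g_adj !adjM !adjK. Qed.

(** ** The quaternionic structure *)

Definition J : M := block_mx 0 (- 1%:M) 1%:M 0.

Lemma JJ : J *m J = - 1%:M.
Proof.
rewrite /J mulmx_block !mul0mx !mulmx0 !mulNmx !mul1mx !addr0 !add0r.
by rewrite (@scalar_mx_block _ n n) opp_block_mx oppr0.
Qed.

Lemma conjJ : cj J = J.
Proof. by rewrite /J map_block_mx !map_mx0 map_mxN map_mx1. Qed.

Lemma trJ : J^T = - J.
Proof.
by rewrite /J tr_block_mx !trmx0 linearN /= trmx1 opp_block_mx opprK oppr0.
Qed.

Lemma adjJ : J^t* = - J.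
Proof. by rewrite trJ conjmxN conjJ. Qed.

Lemma quat_repP X :
  (exists z w, X = quat_rep z w) <-> X *m J = J *m cj X.
Proof.
split=> [[z [w ->]]|].
  rewrite /quat_rep /J /conjm map_block_mx !mulmx_block.
  rewrite conjmxN !conjmxK !mul0mx !mulmx0 !mulNmx !mulmxN !mulmx1 !mul1mx.
  by rewrite !addr0 !add0r.
rewrite -{1 2}[X]submxK /J map_block_mx !mulmx_block.
rewrite !mul0mx !mulmx0 !mulNmx !mulmxN !mulmx1 !mul1mx !addr0 !add0r.
move=> /eq_block_mx[urE _ drE _].
exists (ulsubmx X), (dlsubmx X); rewrite /quat_rep /conjm -urE.
by rewrite -{1}[X]submxK drE.
Qed.

Lemma SpP X : Sp X <-> X *m X^t* = 1%:M /\ X *m J = J *m cj X.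
Proof.
rewrite /Sp /=; split=> -[uX /quat_repP qX]; split => //; exact/unitarymxP.
Qed.

Lemma Sp_adjl X : Sp X -> X^t* *m X = 1%:M.
Proof. by move=> /SpP[/mulmx1C]. Qed.

Lemma Sp_invmx X : Sp X -> invmx X = X^t*.
Proof. by move=> [/invmx_unitary]. Qed.

Lemma SpM X Y : Sp X -> Sp Y -> Sp (X *m Y).
Proof.
move=> /SpP[uX qX] /SpP[uY qY]; apply/SpP; split.
  by rewrite adjM mulmxA -(mulmxA X) uY mulmx1.
by rewrite -mulmxA qY mulmxA qX conjmxM mulmxA.
Qed.

Lemma adjquat X : X *m J = J *m cj X -> X^t* *m J = J *m cj (X^t*).
Proof.
move=> qX; have := congr1 trmx qX.
rewrite !trmx_mul trJ mulNmx mulmxN => /oppr_inj e.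
by rewrite -[X^t*]map_trmx -e map_trmx conjmxK.
Qed.

(** The Lie algebra of the group: the skew-Hermitian quaternionic matrices. *)
Definition sp A : Prop := A^t* = - A /\ A *m J = J *m cj A.

Lemma spD A B : sp A -> sp B -> sp (A + B).
Proof.
move=> [sA qA] [sB qB]; split; first by rewrite adjD sA sB opprD.
by rewrite mulmxDl qA qB conjmxD mulmxDr.
Qed.

Lemma spZ (r : R) A : sp A -> sp (r%:C *: A).
Proof.
have rE : Num.conj (r%:C) = r%:C :> C by apply: Cext; rewrite ?ReJ ?ImJ /= ?oppr0.
move=> [sA qA]; split; first by rewrite adjZ sA scalerN rE.
by rewrite -scalemxAl qA conjmxZ rE -scalemxAr.
Qed.

Lemma spN A : sp A -> sp (- A).
Proof.
move=> [sA qA]; split; first by rewrite adjN sA.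
by rewrite mulNmx qA conjmxN mulmxN.
Qed.

Lemma sp0 : sp 0.
Proof. by split; rewrite ?trmx0 map_mx0 ?oppr0 // mul0mx mulmx0. Qed.

Lemma sp_sum (I : Type) (r : seq I) (F : I -> M) :
  (forall i, sp (F i)) -> sp (\sum_(i <- r) F i).
Proof. by move=> spF; apply: big_ind => //; [exact: sp0|exact: spD]. Qed.

(** The conjugation of B by the antilinear map v |-> J conj v, whose
    commutant consists of the quaternionic matrices. *)
Definition jconj B : M := - (J *m cj B *m J).

Lemma jconjP B : B *m J = J *m cj B <-> jconj B = B.
Proof.
rewrite /jconj; split=> [<-|E].
  by rewrite -mulmxA JJ mulmxN mulmx1 opprK.
by rewrite -{1}E mulNmx -(mulmxA _ J J) JJ mulmxN mulmx1 opprK.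
Qed.

Lemma jconjK : involutive jconj.
Proof.
move=> B; rewrite /jconj conjmxN !conjmxM conjJ conjmxK mulmxN mulNmx opprK.
by rewrite !mulmxA JJ -(mulmxA _ J J) JJ mulmxN mulmx1 mulNmx mul1mx opprK.
Qed.

Lemma jconjD A B : jconj (A + B) = jconj A + jconj B.
Proof. by rewrite /jconj conjmxD mulmxDr mulmxDl opprD. Qed.

Lemma jconjZ (a : C) Z : jconj (a *: Z) = Num.conj a *: jconj Z.
Proof. by rewrite /jconj conjmxZ -scalemxAr -scalemxAl scalerN. Qed.

Lemma jconjN Z : jconj (- Z) = - jconj Z.
Proof. by rewrite /jconj conjmxN mulmxN mulNmx. Qed.

Lemma jconj_adj B : jconj (B^t*) = (jconj B)^t*.
Proof.
by rewrite /jconj adjN !adjM adjJ conj_adj !mulNmx !mulmxN !opprK mulmxA.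
Qed.

Lemma g_jconj A B : g (jconj A) (jconj B) = g A B.
Proof.
rewrite /jconj gNl gNr opprK g_mulmxr g_mulmxl -g_cj adjJ.
rewrite !(mulmxN, mulNmx) !mulmxA JJ -!mulmxA JJ !(mulNmx, mulmxN) opprK.
by rewrite mulmx1 mul1mx opprK !conjmxK.
Qed.

(** The orthogonal projection of the space of matrices onto the Lie algebra,
    which is the fixed space of two commuting isometric involutions, the
    negative of the adjoint and [jconj]; the projection is the average over the
    group that they generate. *)
Definition spproj Z : M :=
  (4%:R^-1 : R)%:C *: ((Z - Z^t*) + jconj (Z - Z^t*)).

Lemma sp_spproj Z : sp (spproj Z).
Proof.
apply: spZ; split; last first.
  by apply/jconjP; rewrite jconjD jconjK addrC.
rewrite adjD -jconj_adj opprD.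
have E : (Z - Z^t*)^t* = - (Z - Z^t*) by rewrite adjD adjN adjK opprB addrC.
by rewrite E /jconj conjmxN mulmxN mulNmx.
Qed.

Lemma g_spproj Z A : sp A -> g (spproj Z) A = g Z A.
Proof.
move=> [sA /jconjP qA]; rewrite /spproj gZl gDl.
have -> : g (jconj (Z - Z^t*)) A = g (Z - Z^t*) A by rewrite -{1}qA g_jconj.
have sE : g (Z^t*) A = - g Z A by rewrite -g_adj adjK sA gNr.
by rewrite gDl gNl sE; field.
Qed.

Lemma sp_ext A B : sp A -> sp B -> (forall D, sp D -> g A D = g B D) -> A = B.
Proof.
move=> sA sB AB; apply/eqP; rewrite -subr_eq0; apply/eqP/g_eq0.
have sAB : sp (A - B) by apply: spD => //; exact: spN.
by rewrite gDl gNl AB // subrr.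
Qed.

(** ** Tangent spaces *)

Definition mderiv (p q : nat) (c : R -> 'M[C]_(p, q)) (V : 'M[C]_(p, q)) :=
  forall i j, cderiv (fun t => c t i j) (V i j).

Lemma mderiv_uniq (p q : nat) (c : R -> 'M[C]_(p, q)) (V W : 'M[C]_(p, q)) :
  mderiv c V -> mderiv c W -> V = W.
Proof. by move=> cV cW; apply/matrixP => i j; apply: cderiv_uniq. Qed.

Lemma mderivM (p q r : nat) (c : R -> 'M[C]_(p, q)) (d : R -> 'M[C]_(q, r))
  (V : 'M[C]_(p, q)) (W : 'M[C]_(q, r)) :
  mderiv c V -> mderiv d W ->
  mderiv (fun t => c t *m d t) (V *m d 0 + c 0 *m W).
Proof.
move=> cV dW i j; rewrite !mxE -big_split /=.
under eq_fun do rewrite mxE.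
by apply: cderiv_sum => k; exact: cderivM.
Qed.

Lemma mderivD (p q : nat) (c d : R -> 'M[C]_(p, q)) (V W : 'M[C]_(p, q)) :
  mderiv c V -> mderiv d W -> mderiv (fun t => c t + d t) (V + W).
Proof.
move=> cV dW i j; rewrite mxE; under eq_fun do rewrite mxE; exact: cderivD.
Qed.

Lemma mderivN (p q : nat) (c : R -> 'M[C]_(p, q)) V :
  mderiv c V -> mderiv (fun t => - c t) (- V).
Proof.
move=> cV i j; rewrite mxE; under eq_fun do rewrite mxE; exact: cderivN.
Qed.

Lemma mderiv_conj (p q : nat) (c : R -> 'M[C]_(p, q)) V :
  mderiv c V -> mderiv (fun t => cj (c t)) (cj V).
Proof.
move=> cV i j; rewrite mxE; under eq_fun do rewrite mxE; exact: cderiv_conj.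
Qed.

Lemma mderiv_tr (p q : nat) (c : R -> 'M[C]_(p, q)) V :
  mderiv c V -> mderiv (fun t => (c t)^T) (V^T).
Proof.
by move=> cV i j; rewrite mxE; under eq_fun do rewrite mxE; exact: cV.
Qed.

Lemma mderiv_cst (p q : nat) (a : 'M[C]_(p, q)) : mderiv (fun=> a) 0.
Proof. by move=> i j; rewrite mxE; exact: cderiv_cst. Qed.

Lemma mderivMl (p q r : nat) (a : 'M[C]_(p, q)) (c : R -> 'M[C]_(q, r)) V :
  mderiv c V -> mderiv (fun t => a *m c t) (a *m V).
Proof.
by move=> cV; have := mderivM (mderiv_cst a) cV; rewrite mul0mx add0r.
Qed.

Lemma mderivMr (p q r : nat) (a : 'M[C]_(q, r)) (c : R -> 'M[C]_(p, q)) V :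
  mderiv c V -> mderiv (fun t => c t *m a) (V *m a).
Proof.
by move=> cV; have := mderivM cV (mderiv_cst a); rewrite mulmx0 addr0.
Qed.

Lemma mderivZ (p q : nat) (a : C) (c : R -> 'M[C]_(p, q)) V :
  mderiv c V -> mderiv (fun t => a *: c t) (a *: V).
Proof.
move=> cV; rewrite -mul_scalar_mx; under eq_fun do rewrite -mul_scalar_mx.
exact: mderivMl.
Qed.

Lemma mderiv_spproj (c : R -> M) V :
  mderiv c V -> mderiv (fun t => spproj (c t)) (spproj V).
Proof.
move=> cV; have dV : mderiv (fun t => c t - (c t)^t*) (V - V^t*).
  exact: (mderivD cV (mderivN (mderiv_conj (mderiv_tr cV)))).
apply: mderivZ; apply: (mderivD dV).
exact: (mderivN (mderivMr J (mderivMl J (mderiv_conj dV)))).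
Qed.

(** The derivatives at 0 of [c c^* = 1] and [c J = J conj c]. *)
Lemma curve_tangent_sp X V (c : R -> M) :
  curve_through X V c -> sp (X^t* *m V).
Proof.
move=> [Spc c0 /= dc]; have dcV : mderiv c V by [].
have [uX qX] : X *m X^t* = 1%:M /\ X *m J = J *m cj X by apply/SpP; rewrite -c0.
have E1 : V *m X^t* + X *m V^t* = 0.
  have := mderivM dcV (mderiv_conj (mderiv_tr dcV)); rewrite c0.
  have -> : (fun t => c t *m (c t)^t*) = fun=> 1%:M.
    by apply/funext => t; have /SpP[] := Spc t.
  by move=> /mderiv_uniq; apply; exact: mderiv_cst.
have E2 : V *m J = J *m cj V.
  have := mderivMr J dcV.
  have -> : (fun t => c t *m J) = fun t => J *m cj (c t).
    by apply/funext => t; have /SpP[] := Spc t.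
  by move=> /mderiv_uniq; apply; exact/mderivMl/mderiv_conj.
split; last by rewrite -mulmxA E2 mulmxA adjquat // conjmxM !mulmxA.
rewrite adjM adjK; move/eqP: E1; rewrite addr_eq0 => /eqP E1.
have -> : X^t* *m V = X^t* *m (V *m X^t*) *m X.
  by rewrite -!mulmxA (mulmx1C uX) mulmx1.
by rewrite E1 mulmxN mulNmx opprK !mulmxA (mulmx1C uX) mul1mx.
Qed.

Lemma real_bound (x y : C) : `|x| <= y ->
  `|complex.Re x| <= complex.Re y /\ `|complex.Im x| <= complex.Re y.
Proof.
move=> xy; have y0 : 0 <= y by apply: le_trans xy.
have yE : y = (complex.Re y)%:C by apply: Cext => //=; exact: ger0_Im.
split; rewrite -lecR -yE; apply: le_trans xy; first exact: normc_ge_Re.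
have := normc_ge_Re (x * 'i); rewrite ReiNIm normrN normrM.
suff -> : `|'i : C| = 1 by rewrite mulr1.
by rewrite normc_def /= expr0n expr1n add0r sqrtr1.
Qed.

(** The derivative at B = 0 is twice the identity, and the definition needs
    only matrix inversion where the exponential would need convergence. *)
Definition cayley B : M := invmx (1%:M - B) *m (1%:M + B).

(** If v = v B, then skewness gives v v^* = - v v^*. *)
Lemma cayley_unit B : B^t* = - B -> 1%:M - B \in unitmx.
Proof.
move=> sB; rewrite -row_free_unit; apply: inj_row_free => v.
rewrite mulmxBr mulmx1 => /eqP; rewrite subr_eq0 => /eqP vB.
apply: mulmx_adj_eq0; have E : v *m v^t* = - (v *m v^t*).
  by rewrite {2}vB adjM sB mulNmx mulmxN mulmxA -vB.
move/eqP: E; rewrite -addr_eq0 -mulr2n -scaler_nat scaler_eq0 pnatr_eq0.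
by move=> /eqP.
Qed.

Lemma cayleyE B : B^t* = - B -> (1%:M - B) *m cayley B = 1%:M + B.
Proof. by move=> /cayley_unit uB; rewrite mulKVmx. Qed.

(** Taking adjoints exchanges the commuting matrices 1 + B and 1 - B. *)
Lemma Sp_cayley B : sp B -> Sp (cayley B).
Proof.
move=> [sB qB]; have uB := cayley_unit sB; apply/SpP.
split; last first.
  apply: (can_inj (mulKmx uB)).
  rewrite (mulmxA _ (cayley B)) (mulmxA _ J) cayleyE //.
  have -> : (1%:M - B) *m J = J *m cj (1%:M - B).
    by rewrite mulmxBl mul1mx qB conjmxD conjmxN conjmx1 mulmxBr mulmx1.
  rewrite -(mulmxA J) -conjmxM cayleyE // conjmxD conjmx1.
  by rewrite mulmxDl mul1mx qB mulmxDr mulmx1.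
have comm : (1%:M + B) *m (1%:M - B) = (1%:M - B) *m (1%:M + B).
  rewrite mulmxDl mul1mx mulmxBr mulmx1 addrA subrK.
  by rewrite mulmxBl mul1mx mulmxDr mulmx1 opprD addrA addrK.
have cB : cayley B *m (1%:M - B) = 1%:M + B.
  by rewrite /cayley -mulmxA comm mulKmx.
apply: (can_inj (mulKmx uB)).
rewrite (mulmxA _ (cayley B)) (cayleyE sB) mulmx1.
have := congr1 (fun D : M => D^t*) cB.
by rewrite adjM !adjD adjN adj1 sB opprK.
Qed.

End Group.

(** * Tangent spaces, orthonormal bases and the Casimir tensor *)

Section Tangent.
Context {R : realType} {n : nat}.
Local Notation C := (R[i]).
Local Notation M := 'M[C]_(n + n).
Local Notation cj := (map_mx Num.conj).
Local Notation jm := (@J R n).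
Implicit Types (X Y Z W A B V : M).

Lemma unitary_entry_le1 (p : nat) (U : 'M[C]_p) i j :
  U *m U^t* = 1%:M -> `|U i j| <= 1.
Proof.
move=> /(congr1 (fun D : 'M[C]_p => D i i)); rewrite !mxE eqxx.
rewrite (bigD1 j) //= !mxE -normCK => e.
rewrite -(@expr_le1 _ 2) // -[leRHS]e lerDl.
by apply: sumr_ge0 => k _; rewrite !mxE mul_conjC_ge0.
Qed.

(** The second-order expansion, with a remainder that involves the transform
    itself and is therefore bounded. *)
Lemma cayley_expand B : B^t* = - B ->
  cayley B = 1%:M + 2%:R *: B + B *m B *m (1%:M + cayley B).
Proof.
move=> sB; have := cayleyE sB; rewrite mulmxBl mul1mx => /eqP.
rewrite subr_eq => /eqP E; rewrite {1}E {1}E.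
rewrite !mulmxDr !mulmx1 mulmxA scaler_nat mulr2n !addrA; congr (_ + _).
Qed.

(** Each element of the Lie algebra is the velocity of a curve in the group:
    the Cayley transform takes the place of the matrix exponential, and its
    unitarity bounds the second-order remainder. *)
Lemma cayley_curve X A : Sp X -> sp A ->
  curve_through X (X *m A) (fun t => X *m cayley ((t / 2)%:C *: A)).
Proof.
move=> SX sA; set c := fun t : R => _.
have sB (t : R) : sp ((t / 2)%:C *: A) by exact: spZ.
have c0 : c 0 = X.
  by rewrite /c mul0r scale0r /cayley subr0 addr0 invmx1 !mulmx1.
pose Z := (4%:R^-1 : C) *: (X *m A *m A).
pose r (t : R) := Z *m (1%:M + cayley ((t / 2)%:C *: A)).
have cE t : c t = X + t%:C *: (X *m A) + (t ^+ 2)%:C *: r t.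
  have [sBt _] := sB t; rewrite /c (cayley_expand sBt) /r.
  set z := (t / 2)%:C; move: (1%:M + cayley (z *: A)) => D.
  rewrite !mulmxDr mulmx1; congr (_ + _ + _).
    rewrite scalerA -scalemxAr; congr (_ *: _).
    by apply: Cext; rewrite !(ReM, ImM) /=; field.
  have -> : z *: A *m (z *: A) = (z * z) *: (A *m A).
    by rewrite -scalemxAl -scalemxAr scalerA.
  rewrite /Z -(scalemxAl _ (A *m A)) -(scalemxAr _ X).
  rewrite -(scalemxAl _ (X *m A *m A)).
  rewrite scalerA !mulmxA; congr (_ *: _).
  by apply: Cext; rewrite !(ReM, ImM) /=; field.
split => [t||i j]; first by apply: SpM => //; exact: Sp_cayley.
  exact: c0.
pose b := `|Z i j| + \sum_k `|Z i k|.
apply: (@cderiv_quadratic _ _ (fun t => r t i j) _ (complex.Re b)).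
  by move=> t; rewrite cE c0 !mxE.
move=> t; apply: real_bound; rewrite /r mulmxDr mulmx1 mxE.
apply: le_trans (ler_normD _ _) _; rewrite lerD2l mxE.
apply: le_trans (ler_norm_sum _ _ _) _; apply: ler_sum => k _.
rewrite normrM ler_piMr //; apply: unitary_entry_le1.
by have /SpP[] := Sp_cayley (sB t).
Qed.

Lemma tangentP X V : Sp X -> tangent X V <-> sp (X^t* *m V).
Proof.
move=> SX; split; first by case=> c /curve_tangent_sp.
move=> sV; exists (fun t => X *m cayley ((t / 2)%:C *: (X^t* *m V))).
have /SpP[uX _] := SX.
by have := cayley_curve SX sV; rewrite mulmxA uX mul1mx.
Qed.

Lemma tangent_mulmx X A : Sp X -> sp A -> tangent X (X *m A).
Proof.
by move=> SX sA; apply/tangentP => //; rewrite mulmxA Sp_adjl // mul1mx.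
Qed.

Lemma tangentE X V : Sp X -> tangent X V -> exists2 A, sp A & V = X *m A.
Proof.
move=> SX /(tangentP _ SX) sV; exists (X^t* *m V) => //.
by have /SpP[uX _] := SX; rewrite mulmxA uX mul1mx.
Qed.

Lemma metric_mulmx X A B : Sp X -> metric X (X *m A) (X *m B) = g A B.
Proof.
by move=> SX; rewrite /metric Sp_invmx // !mulmxA Sp_adjl // !mul1mx.
Qed.

Lemma g_mulmx_Sp X A B : Sp X -> g (X *m A) (X *m B) = g A B.
Proof.
by move=> SX; rewrite g_mulmxl mulmxA Sp_adjl // mul1mx.
Qed.

(** ** Orthonormal bases of the Lie algebra *)

Definition orthonormal (k : nat) (e : 'I_k -> M) : Prop :=
  (forall i, sp (e i)) /\ (forall i j, g (e i) (e j) = (i == j)%:R).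

Definition sp_basis (k : nat) (e : 'I_k -> M) : Prop :=
  orthonormal e /\ forall A, sp A -> A = \sum_i (g A (e i))%:C *: e i.

Lemma g_delta a b W : g (delta_mx a b) W = complex.Re (W a b).
Proof.
rewrite gE (bigD1 a) //= (bigD1 b) //= !mxE !eqxx /= mul1r mul0r addr0.
rewrite big1 => [|j jb]; last by rewrite !mxE eqxx (negbTE jb) /= !mul0r addr0.
rewrite big1 ?addr0 // => i ia; rewrite big1 // => j _.
by rewrite !mxE (negbTE ia) /= !mul0r addr0.
Qed.

Lemma g_idelta a b W : g ('i *: delta_mx a b) W = complex.Im (W a b).
Proof.
rewrite gE (bigD1 a) //= (bigD1 b) //= !mxE !eqxx mulr1 /= mul0r mul1r add0r.
rewrite big1 => [|j jb]; last by rewrite !mxE eqxx (negbTE jb) mulr0 /= !mul0r addr0.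
rewrite big1 ?addr0 // => i ia; rewrite big1 // => j _.
by rewrite !mxE (negbTE ia) mulr0 /= !mul0r addr0.
Qed.

Lemma orthonormal_g_sum k (e : 'I_k -> M) (x : 'I_k -> R) j : orthonormal e ->
  g (\sum_i (x i)%:C *: e i) (e j) = x j.
Proof.
move=> [_ oe]; rewrite g_suml (bigD1 j) //= gZl oe eqxx mulr1.
by rewrite big1 ?addr0 // => i ij; rewrite gZl oe (negbTE ij) mulr0.
Qed.

Lemma bessel k (e : 'I_k -> M) Z : orthonormal e ->
  \sum_i g Z (e i) ^+ 2 <= g Z Z.
Proof.
move=> oe; set P := \sum_i (g Z (e i))%:C *: e i.
have gPP : g P P = \sum_i g Z (e i) ^+ 2.
  rewrite {2}/P g_sumr; apply: eq_bigr => i _.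
  by rewrite gZr orthonormal_g_sum // expr2.
have gZP : g Z P = \sum_i g Z (e i) ^+ 2.
  by rewrite /P g_sumr; apply: eq_bigr => i _; rewrite gZr expr2.
have := g_ge0 (Z - P); rewrite gDl gNl !gDr !gNr gPP gZP (gC P) gZP subrr subr0.
by rewrite subr_ge0.
Qed.

(** The k unit vectors contribute k to the sum of the left-hand sides of
    Bessel's inequality over the unit vectors E_ab and i E_ab. *)
Lemma orthonormal_bound k (e : 'I_k -> M) : orthonormal e ->
  (k <= (n + n) * (n + n) * 2)%N.
Proof.
move=> oe; have [_ gee] := oe; rewrite -(ler_nat R).
have -> : k%:R = \sum_(i < k) g (e i) (e i).
  by rewrite (eq_bigr (fun=> 1)) ?sumr_const ?card_ord // => i _; rewrite gee eqxx.
have -> : \sum_(i < k) g (e i) (e i) = \sum_a \sum_b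
   (\sum_i g (delta_mx a b) (e i) ^+ 2 + \sum_i g ('i *: delta_mx a b) (e i) ^+ 2).
  under eq_bigr do rewrite gE.
  rewrite exchange_big; apply: eq_bigr => a _.
  rewrite exchange_big; apply: eq_bigr => b _.
  by rewrite -big_split; apply: eq_bigr => i _; rewrite g_delta g_idelta !expr2.
have -> : ((n + n) * (n + n) * 2)%:R = \sum_(a < n + n) \sum_(b < n + n) 2 :> R.
  by rewrite !sumr_const !card_ord -!mulrnA; congr (_ *+ _); rewrite mulnC mulnA.
apply: ler_sum => a _; apply: ler_sum => b _.
rewrite [leRHS](_ : _ = 1 + 1) // lerD //.
  by apply: le_trans (bessel _ oe) _; rewrite g_delta !mxE !eqxx.
by apply: le_trans (bessel _ oe) _; rewrite g_idelta !mxE !eqxx mulr1.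
Qed.

(** An orthonormal family of maximal size spans: otherwise the normalised
    component of some vector orthogonal to the family would enlarge it. *)
Lemma sp_basis_exists : exists k (e : 'I_k -> M), sp_basis e.
Proof.
pose P k := `[< exists e : 'I_k -> M, orthonormal e >].
have exP : exists k, P k.
  exists 0%N; apply/asboolP; exists (fun=> 0); split; case=> //.
have ubP k : P k -> (k <= (n + n) * (n + n) * 2)%N.
  by move=> /asboolP[e]; exact: orthonormal_bound.
case: (ex_maxnP exP ubP) => k /asboolP[e oe] kmax; exists k, e; split=> // A sA.
apply/eqP; rewrite -subr_eq0; apply/negPn/negP => V0.
set V := A - _ in V0; have [spe gee] := oe.
have sV : sp V.
  by apply: spD => //; apply: spN; apply: sp_sum => i; exact: spZ.
have gVe i : g V (e i) = 0 by rewrite gDl gNl orthonormal_g_sum // subrr.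
have gVV : 0 < g V V.
  by rewrite lt0r g_ge0 andbT; apply: contra_neq V0; exact: g_eq0.
pose f (i : 'I_k.+1) := if unlift ord_max i is Some j then e j
  else ((Num.sqrt (g V V))^-1)%:C *: V.
suff /kmax : P k.+1 by rewrite ltnn.
apply/asboolP; exists f; split.
  by move=> i; rewrite /f; case: unliftP => [j|] _ //; exact: spZ.
move=> i j; rewrite /f; case: unliftP => [i'|] ->; case: unliftP => [j'|] ->.
- by rewrite gee (inj_eq (@lift_inj _ _)).
- by rewrite gZr gC gVe mulr0 eq_sym (negbTE (neq_lift _ _)).
- by rewrite gZl gVe mulr0 (negbTE (neq_lift _ _)).
rewrite gZl gZr eqxx mulrA -expr2 exprVn sqr_sqrtr ?ltW // mulVf //.
by rewrite gt_eqF.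
Qed.

Lemma orthonormal_basisP X k (e : 'I_k -> M) : Sp X ->
  orthonormal_basis X e <-> sp_basis (fun i => X^t* *m e i).
Proof.
move=> SX; have /SpP[uX _] := SX.
have mE V W : metric X V W = g (X^t* *m V) (X^t* *m W).
  by rewrite /metric Sp_invmx.
split=> [[te me be]|[[se ge] be]].
  split; first by split=> [i|i j]; [exact/(tangentP _ SX)|rewrite -mE me].
  move=> A sA; have := be _ (tangent_mulmx SX sA).
  move=> /(congr1 (fun U : M => X^t* *m U)).
  rewrite mulmxA Sp_adjl // mul1mx => {1}->.
  rewrite mulmx_sumr; apply: eq_bigr => i _; rewrite -scalemxAr mE.
  by rewrite mulmxA Sp_adjl // mul1mx.
split=> [i|i j|U tU]; [exact/tangentP|by rewrite mE ge|].
have := be _ ((tangentP _ SX).1 tU) => /(congr1 (fun U : M => X *m U)).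
rewrite mulmxA uX mul1mx => {1}->; rewrite mulmx_sumr.
by apply: eq_bigr => i _; rewrite -scalemxAr mulmxA uX mul1mx mE.
Qed.

(** ** The Casimir tensor *)

(** The value of the tensor sum_i e_i (x) e_i for an orthonormal basis e of
    the Lie algebra ([casimirE]). *)
Definition casimir (a b c d : 'I_(n + n)) : C :=
  - 2%:R^-1 * ((b == c)%:R * (a == d)%:R + jm c a * jm b d).

Lemma J_delta_J a b c d : (jm *m delta_mx a b *m jm) c d = jm c a * jm b d.
Proof.
rewrite mxE (bigD1 b) //= big1 => [|k kb]; last first.
  rewrite mxE big1 ?mul0r // => l _.
  by rewrite !mxE (negbTE kb) andbF mulr0.
rewrite addr0 mxE (bigD1 a) //= big1 => [|k ka]; last first.
  by rewrite [X in _ * X]mxE (negbTE ka) mulr0.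
by rewrite addr0 [X in _ * X * _]mxE !eqxx mulr1.
Qed.

Lemma spproj_sum k (e : 'I_k -> M) Z : sp_basis e ->
  spproj Z = \sum_i (g Z (e i))%:C *: e i.
Proof.
move=> [[se _] /(_ _ (sp_spproj Z)) {1}->].
by apply: eq_bigr => i _; rewrite g_spproj.
Qed.

(** For a complex-linear L the sum L(Z) + i L(i Z) vanishes, and for an
    antilinear L it is 2 L(Z); only the antilinear half of the four terms of
    the projection survives. *)
Lemma spproj_antilinear Z :
  spproj Z + 'i *: spproj ('i *: Z) = 2%:R^-1 *: (jconj Z - Z^t*).
Proof.
have iE : Num.conj ('i : C) = - 'i by apply: Cext; rewrite ?ReJ ?ImJ /= ?oppr0.
have i2 : 'i * 'i = - 1 :> C by rewrite -expr2 sqr_i.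
have r4 : (4%:R^-1)%:C = 4%:R^-1 :> C by rewrite [LHS]fmorphV rmorph_nat.
rewrite /spproj r4 (adjZ 'i) iE scaleNr opprK !jconjD jconjN !jconjZ iE.
move: (map_mx _ _) => S; move: (jconj Z) (jconj S) => P Q.
apply/matrixP => i j; rewrite !mxE.
move: (Z i j) (P i j) (Q i j) (S i j) => z p q s.
rewrite (_ : 'i * _ = 4%:R^-1 * (('i * 'i) * (z + s - p - q))); last by ring.
by rewrite i2; field.
Qed.

(** The coefficients of E_ab and i E_ab along e_i are the real and the imaginary
    part of the (a, b) entry of e_i, so the sum is the (c, d) entry of
    [spproj E_ab + i spproj (i E_ab)]. *)
Lemma casimirE k (e : 'I_k -> M) a b c d : sp_basis e ->
  \sum_i e i a b * e i c d = casimir a b c d.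
Proof.
move=> be.
have -> : \sum_i e i a b * e i c d =
    (spproj (delta_mx a b) + 'i *: spproj ('i *: delta_mx a b)) c d.
  rewrite !(spproj_sum _ be) scaler_sumr -big_split summxE.
  apply: eq_bigr => i _; rewrite g_delta g_idelta !mxE mulrA -mulrDl.
  by congr (_ * _); exact: complexE.
have jd : jconj (delta_mx a b) c d = - (jm c a * jm b d).
  by rewrite /jconj map_delta_mx mxE J_delta_J.
have ad : (map_mx Num.conj (delta_mx a b : M)^T) c d = (b == c)%:R * (a == d)%:R.
  by rewrite !mxE rmorph_nat -natrM mulnb (eq_sym c) (eq_sym d) andbC.
rewrite spproj_antilinear mxE [X in _ * X]mxE jd [X in _ + X]mxE ad /casimir.
by ring.
Qed.
End Tangent.

(** * The Laplace-Beltrami operator in a left-invariant frame *)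

Section LaplaceBeltrami.
Context {R : realType} {n : nat}.
Local Notation C := (R[i]).
Local Notation M := 'M[C]_(n + n).
Local Notation cj := (map_mx Num.conj).
Implicit Types (X Y Z A B V : M).

Lemma differentialE (u : M -> R) X V (d : R) : tangent X V ->
  (forall c, curve_through X V c ->
     is_derive (0 : R) (1 : R) (fun t => u (c t)) d) ->
  differential u X V = d.
Proof.
move=> [c cV] ud; apply: xget_subset1 => // x y.
by move=> /(_ _ cV) [_ <-] /(_ _ cV) [_ <-].
Qed.

(** Openness of W in the group, as far as curves detect it. *)
Definition open_along_curves (W : set M) : Prop :=
  W `<=` Sp /\ forall X V c, W X -> curve_through X V c ->
    \forall t \near (0 : R), W (c t).

(** [D X a b] stands for the derivative of F along the left-invariant complex
    vector field X |-> X E_ab; the pairings with elements A of the Lie algebra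
    are the derivatives along curves in the group. *)
Definition frame_derivative (W : set M) (F : M -> C) (D : M -> M) : Prop :=
  forall X A c, W X -> curve_through X (X *m A) c ->
    cderiv (fun t => F (c t)) (\sum_a \sum_b A a b * D X a b).

Lemma frame_derivative_near W F G D : open_along_curves W ->
  (forall X, W X -> F X = G X) ->
  frame_derivative W F D -> frame_derivative W G D.
Proof.
move=> [_ oW] FG dF X A c WX cA; apply: cderiv_near (dF X A c WX cA).
by have := oW _ _ _ WX cA; apply: filterS => t /FG.
Qed.

Lemma frame_pairing A Z :
  g A (cj Z) = complex.Re (\sum_a \sum_b A a b * Z a b).
Proof.
rewrite gE Re_sum; apply: eq_bigr => a _; rewrite Re_sum; apply: eq_bigr => b _.
by rewrite ReM !mxE ReJ ImJ mulrN.
Qed.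

Section OneFunction.
Variables (W : set M) (F : M -> C) (D : M -> M).
Variable H : 'I_(n + n) -> 'I_(n + n) -> M -> M.
Hypothesis (oW : open_along_curves W) (dF : frame_derivative W F D).

Let SpW X : W X -> Sp X. Proof. by case: oW => + _; apply. Qed.

(** The real part of the pairing of A with the derivatives along the fields
    X E_ab is the scalar product of A with the conjugate of [D X]. *)
Lemma gradientE X : W X ->
  gradient (fun Y => complex.Re (F Y)) X = X *m spproj (cj (D X)).
Proof.
move=> WX; have SX := SpW WX.
have dE A : sp A -> differential (fun Y => complex.Re (F Y)) X (X *m A) =
    g (spproj (cj (D X))) A.
  move=> sA; apply: differentialE; first exact: tangent_mulmx.
  move=> c /(dF WX)[dR _]; by rewrite g_spproj // gC frame_pairing.
apply: xget_subset1.
  split; first by apply: tangent_mulmx => //; exact: sp_spproj.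
  by move=> _ /(tangentE SX)[A sA ->]; rewrite metric_mulmx // dE.
move=> _ _ [/(tangentE SX)[A sA ->] mA] [/(tangentE SX)[B sB ->] mB].
congr (_ *m _); apply: sp_ext => // E sE.
have tE := tangent_mulmx SX sE.
by rewrite -!(metric_mulmx _ _ SX) mA // mB.
Qed.

Hypothesis dD : forall a b, frame_derivative W (fun X => D X a b) (H a b).

(** The gradient is the left translate of a Lie-algebra valued function; the
    product rule separates the derivative of the translation from that of the
    function. *)
Lemma ambient_gradientE X A : W X -> sp A ->
  ambient_derivative (gradient (fun Y => complex.Re (F Y))) X (X *m A) =
  X *m A *m spproj (cj (D X)) +
  X *m spproj (cj (\matrix_(a, b) \sum_c \sum_d A c d * H a b X c d)).
Proof.
move=> WX sA; have SX := SpW WX.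
set E := _ + _; have tA := tangent_mulmx SX sA.
have dE c : curve_through X (X *m A) c ->
    mderiv (fun t => gradient (fun Y => complex.Re (F Y)) (c t)) E.
  move=> cA; case: (cA) => _ c0 dc.
  have dDc : mderiv (fun t => D (c t))
      (\matrix_(a, b) \sum_c \sum_d A c d * H a b X c d).
    by move=> a b; rewrite mxE; exact: dD.
  have := mderivM dc (mderiv_spproj (mderiv_conj dDc)); rewrite c0 => dG i j.
  apply: cderiv_near (dG i j).
  by have := oW.2 _ _ _ WX cA; apply: filterS => t /gradientE ->.
apply/matrixP => i j; rewrite mxE.
apply: Cext => /=; apply: differentialE => // c /dE /(_ i j) [] //.
Qed.

Lemma g_levi_civita (V : M -> M) X U A : Sp X -> sp A ->
  g (levi_civita V X U) (X *m A) = g (ambient_derivative V X U) (X *m A).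
Proof.
move=> SX sA; rewrite /levi_civita /tangential_part.
set Z := ambient_derivative V X U.
set T := [set V0 | _].
have [] : T (xget 0 T).
  apply: xgetPex; exists (X *m spproj (X^t* *m Z)); split.
    by apply: tangent_mulmx => //; exact: sp_spproj.
  move=> _ /(tangentE SX)[B sB ->].
  rewrite gDl gNl g_mulmx_Sp // g_spproj //.
  have /SpP[uX _] := SX.
  by rewrite -(g_mulmx_Sp (X^t* *m Z) _ SX) mulmxA uX mul1mx subrr.
move=> _ /(_ _ (tangent_mulmx SX sA)); rewrite gDl gNl => /eqP.
by rewrite subr_eq0 => /eqP.
Qed.

(** The trace of the product of the skew matrix B with the Hermitian matrix
    A^* A is imaginary.  Hence the derivative of the translation contributes
    nothing to a divergence. *)
Lemma g_mulmx_skew A B : sp A -> sp B -> g (A *m B) A = 0.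
Proof.
move=> [sA _] [sB _]; have : g (A *m B) A = - g (A *m B) A.
  by rewrite {1}g_mulmxr sB mulmxN gNr gC.
by move=> /eqP; rewrite -subr_eq0 opprK -mulr2n mulrn_eq0 => /eqP.
Qed.

Lemma g_left_field X A B Z : Sp X -> sp A -> sp B ->
  g (X *m A *m B + X *m Z) (X *m A) = g Z A.
Proof.
move=> SX sA sB; rewrite gDl -(mulmxA X A B) !g_mulmx_Sp //.
by rewrite (g_mulmx_skew sA sB) add0r.
Qed.

Lemma metric_levi_civita X A : W X -> sp A ->
  metric X (levi_civita (gradient (fun Y => complex.Re (F Y))) X (X *m A))
    (X *m A) =
  g (cj (\matrix_(a, b) \sum_c \sum_d A c d * H a b X c d)) A.
Proof.
move=> WX sA; have SX := SpW WX.
rewrite metricE; last by case: SX.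
rewrite (g_levi_civita _ _ SX sA).
rewrite (ambient_gradientE WX sA) (g_left_field _ SX sA (sp_spproj _)).
exact: g_spproj.
Qed.

(** The existence of an orthonormal basis makes the divergence well defined; that
    its value is the same for all of them is the content of [casimirE]. *)
Lemma laplacian_ReE X : W X -> laplacian (fun Y => complex.Re (F Y)) X =
  complex.Re (\sum_a \sum_b \sum_c \sum_d casimir a b c d * H a b X c d).
Proof.
move=> WX; have SX := SpW WX; rewrite /laplacian /divergence.
set rhs := complex.Re _.
have dE k (e : 'I_k -> M) : orthonormal_basis X e ->
   \sum_i metric X
     (levi_civita (gradient (fun Y => complex.Re (F Y))) X (e i)) (e i) = rhs.
  move=> be; have bA := (orthonormal_basisP e SX).1 be; have [[sA _] _] := bA.
  have eE i : e i = X *m (X^t* *m e i).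
    by rewrite mulmxA; have /SpP[-> _] := SX; rewrite mul1mx.
  transitivity (\sum_i g (cj (\matrix_(a, b) \sum_c \sum_d
      (X^t* *m e i) c d * H a b X c d)) (X^t* *m e i)).
    by apply: eq_bigr => i _; rewrite {1 2}eE metric_levi_civita.
  transitivity (\sum_i complex.Re (\sum_a \sum_b \sum_c \sum_d
     (X^t* *m e i) a b * (X^t* *m e i) c d * H a b X c d)).
    apply: eq_bigr => i _; rewrite gC frame_pairing; congr complex.Re.
    apply: eq_bigr => a _; apply: eq_bigr => b _; rewrite [X in _ * X]mxE mulr_sumr.
    by apply: eq_bigr => c _; rewrite mulr_sumr; apply: eq_bigr => d _; rewrite mulrA.
  rewrite -Re_sum /rhs; congr complex.Re.
  rewrite exchange_big; apply: eq_bigr => a _.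
  rewrite exchange_big; apply: eq_bigr => b _.
  rewrite exchange_big; apply: eq_bigr => c _.
  rewrite exchange_big; apply: eq_bigr => d _.
  by rewrite -mulr_suml (casimirE _ _ _ _ bA).
apply: xget_subset1; first by move=> k e be; rewrite dE.
have [k [e be]] := @sp_basis_exists R n.
have bX : orthonormal_basis X (fun i => X *m e i).
  apply/orthonormal_basisP => //.
  have -> : (fun i => X^t* *m (X *m e i)) = e; last exact: be.
  by apply/funext => i; rewrite mulmxA Sp_adjl // mul1mx.
by move=> x y /(_ _ _ bX) -> /(_ _ _ bX) ->.
Qed.

End OneFunction.

(** The imaginary part of F is the real part of - i F, so the formula for real
    parts gives the complex one. *)
Lemma tauE (W : set M) (F : M -> C) (D : M -> M)
    (H : 'I_(n + n) -> 'I_(n + n) -> M -> M) X :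
  open_along_curves W -> frame_derivative W F D ->
  (forall a b, frame_derivative W (fun X => D X a b) (H a b)) -> W X ->
  tau F X = \sum_a \sum_b \sum_c \sum_d casimir a b c d * H a b X c d.
Proof.
move=> oW dF dD WX; rewrite /tau (laplacian_ReE oW dF dD WX).
have scale (F1 : M -> C) D1 : frame_derivative W F1 D1 ->
    frame_derivative W (fun Y => - 'i * F1 Y) (fun Y => - 'i *: D1 Y).
  move=> dF1 Y A c WY cA.
  have := cderivM (cderiv_cst (- 'i)) (dF1 Y A c WY cA); rewrite mul0r add0r.
  congr cderiv; rewrite mulr_sumr; apply: eq_bigr => a _; rewrite mulr_sumr.
  by apply: eq_bigr => b _; rewrite mxE mulrCA.
have ImE (z : C) : complex.Im z = complex.Re (- 'i * z).
  by rewrite ReM ReN ImN /=; ring.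
have dD' a b :
    frame_derivative W (fun Y => (- 'i *: D Y) a b) (fun Y => - 'i *: H a b Y).
  have -> : (fun Y => (- 'i *: D Y) a b) = (fun Y => - 'i * D Y a b).
    by apply/funext => Y; rewrite mxE.
  exact: scale.
have -> : (fun Y => complex.Im (F Y)) = (fun Y => complex.Re (- 'i * F Y)).
  by apply/funext => Y; rewrite ImE.
rewrite (laplacian_ReE oW (scale _ _ dF) dD' WX).
apply: Cext => //=; rewrite ImE; congr complex.Re.
rewrite mulr_sumr; apply: eq_bigr => a _; rewrite mulr_sumr; apply: eq_bigr => b _.
rewrite mulr_sumr; apply: eq_bigr => c _; rewrite mulr_sumr; apply: eq_bigr => d _.
by rewrite mxE mulrCA.
Qed.

End LaplaceBeltrami.

(** * Products, inverses and matrix coefficients *)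

Section SecondOrder.
Context {R : realType} {n : nat}.
Local Notation C := (R[i]).
Local Notation M := 'M[C]_(n + n).
Local Notation I := 'I_(n + n).
Local Notation jm := (@J R n).
Implicit Types (X Y Z A V : M) (W : set M) (F G : M -> C) (D E : M -> M).

Definition casimir_sum (T : I -> I -> I -> I -> C) : C :=
  \sum_a \sum_b \sum_c \sum_d casimir a b c d * T a b c d.

Lemma eq_casimir_sum S T : (forall a b c d, S a b c d = T a b c d) ->
  casimir_sum S = casimir_sum T.
Proof.
move=> ST; apply: eq_bigr => a _; apply: eq_bigr => b _; apply: eq_bigr => c _.
by apply: eq_bigr => d _; rewrite ST.
Qed.

Lemma casimir_sumD S T :
  casimir_sum (fun a b c d => S a b c d + T a b c d) = casimir_sum S + casimir_sum T.
Proof.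
rewrite /casimir_sum -big_split; apply: eq_bigr => a _; rewrite -big_split.
apply: eq_bigr => b _; rewrite -big_split; apply: eq_bigr => c _.
by rewrite -big_split; apply: eq_bigr => d _; rewrite mulrDr.
Qed.

Lemma casimir_sumZ x T :
  casimir_sum (fun a b c d => x * T a b c d) = x * casimir_sum T.
Proof.
rewrite mulr_sumr; apply: eq_bigr => a _; rewrite mulr_sumr.
apply: eq_bigr => b _; rewrite mulr_sumr; apply: eq_bigr => c _.
by rewrite mulr_sumr; apply: eq_bigr => d _; rewrite mulrCA.
Qed.

(** The conformality operator, the complex-bilinear product of two gradients. *)
Definition kappa Y Z : C := casimir_sum (fun a b c d => Y a b * Z c d).

Lemma kappaC Y Z : kappa Y Z = kappa Z Y.
Proof.
have swap (T : I -> I -> I -> I -> C) : \sum_a \sum_b \sum_c \sum_d T a b c d =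
    \sum_c \sum_d \sum_a \sum_b T a b c d.
  under eq_bigr => a _ do rewrite exchange_big.
  rewrite exchange_big; apply: eq_bigr => c _.
  under eq_bigr => a _ do rewrite exchange_big.
  by rewrite exchange_big.
rewrite /kappa /casimir_sum swap.
apply: eq_bigr => a _; apply: eq_bigr => b _; apply: eq_bigr => c _.
apply: eq_bigr => d _; rewrite [Y c d * _]mulrC; congr (_ * _).
have Jsym k l : jm k l = - jm l k.
  by have /matrixP/(_ l k) := @trJ R n; rewrite !mxE.
rewrite /casimir (Jsym a c) (Jsym d b) mulrNN (eq_sym d) (eq_sym c).
by rewrite [_%:R * _%:R]mulrC.
Qed.

Lemma kappaDl Y Z V : kappa (Y + Z) V = kappa Y V + kappa Z V.
Proof.
rewrite /kappa -casimir_sumD; apply: eq_casimir_sum => a b c d.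
by rewrite mxE mulrDl.
Qed.

Lemma kappaZl x Y Z : kappa (x *: Y) Z = x * kappa Y Z.
Proof.
rewrite /kappa -casimir_sumZ; apply: eq_casimir_sum => a b c d.
by rewrite mxE mulrA.
Qed.

Lemma kappaDr Y Z V : kappa V (Y + Z) = kappa V Y + kappa V Z.
Proof. by rewrite ![kappa V _]kappaC kappaDl. Qed.

Lemma kappaZr x Y Z : kappa Y (x *: Z) = x * kappa Y Z.
Proof. by rewrite ![kappa Y _]kappaC kappaZl. Qed.

(** ** Derivation rules *)

Lemma frame_pairingD A Y Z :
  \sum_a \sum_b A a b * (Y + Z) a b =
  \sum_a \sum_b A a b * Y a b + \sum_a \sum_b A a b * Z a b :> C.
Proof.
rewrite -big_split; apply: eq_bigr => a _; rewrite -big_split.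
by apply: eq_bigr => b _; rewrite mxE mulrDr.
Qed.

Lemma frame_pairingZ A x Z :
  \sum_a \sum_b A a b * (x *: Z) a b = x * (\sum_a \sum_b A a b * Z a b) :> C.
Proof.
rewrite mulr_sumr; apply: eq_bigr => a _; rewrite mulr_sumr.
by apply: eq_bigr => b _; rewrite mxE mulrCA.
Qed.

Lemma frame_derivativeD W F G D E :
  frame_derivative W F D -> frame_derivative W G E ->
  frame_derivative W (fun X => F X + G X) (fun X => D X + E X).
Proof.
move=> dF dG X A c WX cA; rewrite frame_pairingD.
by apply: cderivD; [exact: dF|exact: dG].
Qed.

Lemma frame_derivativeM W F G D E :
  frame_derivative W F D -> frame_derivative W G E ->
  frame_derivative W (fun X => F X * G X) (fun X => F X *: E X + G X *: D X).
Proof.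
move=> dF dG X A c WX cA; rewrite frame_pairingD !frame_pairingZ.
have := cderivM (dF X A c WX cA) (dG X A c WX cA).
by have [_ -> _] := cA; congr cderiv; rewrite addrC [X in _ + X]mulrC.
Qed.

Lemma frame_derivativeZ W (x : C) F D : frame_derivative W F D ->
  frame_derivative W (fun X => x * F X) (fun X => x *: D X).
Proof.
move=> dF X A c WX cA; rewrite frame_pairingZ.
by have := cderivM (cderiv_cst x) (dF X A c WX cA); rewrite mul0r add0r.
Qed.

Lemma frame_derivativeV W F D : (forall X, W X -> F X != 0) ->
  frame_derivative W F D ->
  frame_derivative W (fun X => (F X)^-1) (fun X => - ((F X)^-1 * (F X)^-1) *: D X).
Proof.
move=> F0 dF X A c WX cA; rewrite frame_pairingZ.
have [_ c0 _] := cA; have := cderivV (dF X A c WX cA).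
by rewrite c0 => /(_ (F0 X WX)); congr cderiv; rewrite expr2 !mulNr mulrC.
Qed.

(** The first derivative is recorded along with the value l of the
    second-order operator because the product rule needs it. *)
Definition second_order W F D (l : M -> C) : Prop :=
  frame_derivative W F D /\
  exists H : I -> I -> M -> M,
    (forall a b, frame_derivative W (fun X => D X a b) (H a b)) /\
    forall X, W X -> casimir_sum (fun a b c d => H a b X c d) = l X.

Lemma second_order_tau W F D l X : open_along_curves W ->
  second_order W F D l -> W X -> tau F X = l X.
Proof.
move=> oW [dF [H [dD lE]]] WX; rewrite -lE //.
exact: tauE oW dF dD WX.
Qed.

Lemma second_order_near W F G D l : open_along_curves W ->
  (forall X, W X -> F X = G X) -> second_order W F D l -> second_order W G D l.
Proof. by move=> oW FG [dF dD]; split=> //; exact: frame_derivative_near dF. Qed.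

Lemma second_orderD W F G D E k l :
  second_order W F D k -> second_order W G E l ->
  second_order W (fun X => F X + G X) (fun X => D X + E X) (fun X => k X + l X).
Proof.
move=> [dF [H [dD kE]]] [dG [K [dE lE]]]; split; first exact: frame_derivativeD.
exists (fun a b X => H a b X + K a b X); split=> [a b|X WX].
  have -> : (fun X => (D X + E X) a b) = (fun X => D X a b + E X a b).
    by apply/funext => X; rewrite mxE.
  exact: frame_derivativeD.
rewrite -kE // -lE // -casimir_sumD.
by apply: eq_casimir_sum => a b c d; rewrite mxE.
Qed.

Lemma second_orderZ W x F D l : second_order W F D l ->
  second_order W (fun X => x * F X) (fun X => x *: D X) (fun X => x * l X).
Proof.
move=> [dF [H [dD lE]]]; split; first exact: frame_derivativeZ.
exists (fun a b X => x *: H a b X); split=> [a b|X WX].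
  have -> : (fun X => (x *: D X) a b) = (fun X => x * D X a b).
    by apply/funext => X; rewrite mxE.
  exact: frame_derivativeZ.
rewrite -lE // -casimir_sumZ.
by apply: eq_casimir_sum => a b c d; rewrite mxE.
Qed.

Lemma second_orderM W F G D E k l :
  second_order W F D k -> second_order W G E l ->
  second_order W (fun X => F X * G X) (fun X => F X *: E X + G X *: D X)
    (fun X => k X * G X + 2%:R * kappa (D X) (E X) + F X * l X).
Proof.
move=> [dF [H [dD kE]]] [dG [K [dE lE]]]; split; first exact: frame_derivativeM.
exists (fun a b X => (F X *: K a b X + E X a b *: D X) +
                     (G X *: H a b X + D X a b *: E X)); split=> [a b|X WX].
  have -> : (fun X => (F X *: E X + G X *: D X) a b) =
            (fun X => F X * E X a b + G X * D X a b).
    by apply/funext => X; rewrite !mxE.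
  by apply: frame_derivativeD; apply: frame_derivativeM.
rewrite -kE // -lE //.
transitivity (casimir_sum (fun a b c d => (F X * K a b X c d + E X a b * D X c d) +
                     (G X * H a b X c d + D X a b * E X c d))).
  by apply: eq_casimir_sum => a b c d; rewrite !mxE.
rewrite !casimir_sumD !casimir_sumZ -!/(kappa _ _) (kappaC (E X)).
by ring.
Qed.

(** The rule for an inverse u is the one for products, with D u = - u^2 D F
    differentiated once more. *)
Lemma second_orderV W F D l : (forall X, W X -> F X != 0) ->
  second_order W F D l ->
  second_order W (fun X => (F X)^-1) (fun X => - ((F X)^-1 * (F X)^-1) *: D X)
    (fun X => - ((F X)^-1 * (F X)^-1) * l X +
              2%:R * ((F X)^-1 * (F X)^-1 * (F X)^-1) * kappa (D X) (D X)).
Proof.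
move=> F0 [dF [H [dD lE]]]; have dV := frame_derivativeV F0 dF.
split=> //.
have dU : frame_derivative W (fun X => -1 * ((F X)^-1 * (F X)^-1)) _ :=
  frame_derivativeZ (-1) (frame_derivativeM dV dV).
eexists; split=> [a b|X WX].
  have -> : (fun X => (- ((F X)^-1 * (F X)^-1) *: D X) a b) =
            (fun X => (-1 * ((F X)^-1 * (F X)^-1)) * D X a b).
    by apply/funext => X; rewrite mxE mulN1r.
  exact: frame_derivativeM dU (dD a b).
set u := (F X)^-1.
transitivity (casimir_sum (fun a b c d => (- (u * u)) * H a b X c d +
   (2%:R * (u * u * u)) * (D X a b * D X c d))).
  by apply: eq_casimir_sum => a b c d; rewrite !mxE -/u; ring.
by rewrite casimir_sumD !casimir_sumZ lE.
Qed.

(** ** Matrix coefficients *)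

Definition coef (p : 'cV[C]_(n + n)) (i : I) X : C := (p^T *m X) 0 i.

(** Along X E_ab the row p^T X moves with velocity p^T X E_ab, whose only entry
    is that of index b. *)
Definition dcoef p i X : M := \matrix_(a, b) (coef p a X * (b == i)%:R).

Lemma frame_derivative_coef W p i : frame_derivative W (coef p i) (dcoef p i).
Proof.
move=> X A c WX cA; have [_ c0 dc] := cA.
have dcA : mderiv c (X *m A) by [].
have := mderivMl p^T dcA 0 i; congr cderiv.
rewrite mulmxA mxE; apply: eq_bigr => a _.
rewrite (bigD1 i) //= big1 => [|b bi]; last by rewrite mxE (negbTE bi) !mulr0.
by rewrite addr0 [dcoef _ _ _ _ _]mxE eqxx mulr1 mulrC.
Qed.

Lemma sum_delta (T : finType) (F : T -> C) i : \sum_j F j * (j == i)%:R = F i.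
Proof.
rewrite (bigD1 i) //= eqxx mulr1 big1 ?addr0 // => j /negbTE ->; exact: mulr0.
Qed.

(** The Casimir tensor contributes the exchange of the two columns and a term
    with the factor J_ij. *)
Lemma kappa_dcoef p q i j X : jm i j = 0 ->
  kappa (dcoef p i X) (dcoef q j X) = - 2%:R^-1 * (coef p j X * coef q i X).
Proof.
move=> Jij.
transitivity (\sum_a \sum_c casimir a i c j * (coef p a X * coef q c X)).
  apply: eq_bigr => a _.
  transitivity (\sum_b (\sum_c casimir a b c j * (coef p a X * coef q c X)) *
                       (b == i)%:R).
    apply: eq_bigr => b _; rewrite mulr_suml; apply: eq_bigr => c _.
    transitivity (\sum_d (casimir a b c d * (coef p a X * coef q c X) *
                         (b == i)%:R) * (d == j)%:R).
      by apply: eq_bigr => d _; rewrite !mxE; ring.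
    by rewrite sum_delta.
  by rewrite sum_delta.
transitivity (\sum_a (\sum_c (- 2%:R^-1 * (coef p a X * coef q c X)) *
                              (c == i)%:R) * (a == j)%:R).
  apply: eq_bigr => a _; rewrite mulr_suml; apply: eq_bigr => c _.
  by rewrite /casimir Jij mulr0 addr0 (eq_sym i); ring.
by rewrite !sum_delta.
Qed.

(** The matrix coefficients of the standard representation are
    eigenfunctions: by Schur's lemma the Casimir element acts by a constant,
    here - (2 n + 1) / 2. *)
Lemma second_order_coef W p i : second_order W (coef p i) (dcoef p i)
  (fun X => - 2%:R^-1 * (n + n).+1%:R * coef p i X).
Proof.
split; first exact: frame_derivative_coef.
exists (fun a b X => (b == i)%:R *: dcoef p a X); split=> [a b|X WX].
  have -> : (fun X => dcoef p i X a b) = (fun X => (b == i)%:R * coef p a X).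
    by apply/funext => X; rewrite mxE mulrC.
  by apply: frame_derivativeZ; exact: frame_derivative_coef.
transitivity (\sum_a \sum_c casimir a i c a * coef p c X).
  apply: eq_bigr => a _.
  transitivity (\sum_b (\sum_c casimir a b c a * coef p c X) * (b == i)%:R).
    apply: eq_bigr => b _; rewrite mulr_suml; apply: eq_bigr => c _.
    transitivity (\sum_d (casimir a b c d * coef p c X * (b == i)%:R) * (d == a)%:R).
      by apply: eq_bigr => d _; rewrite !mxE; ring.
    by rewrite sum_delta.
  by rewrite sum_delta.
rewrite exchange_big.
transitivity (\sum_c (- 2%:R^-1 * (n + n).+1%:R * coef p c X) * (c == i)%:R).
  apply: eq_bigr => c _; rewrite -mulr_suml.
  have -> : \sum_a casimir a i c a = - 2%:R^-1 * ((n + n).+1%:R * (c == i)%:R) :> C.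
    rewrite -mulr_sumr; congr (_ * _); rewrite big_split /=.
    have -> : \sum_(a < n + n) (i == c)%:R * (a == a)%:R = (n + n)%:R * (c == i)%:R :> C.
      rewrite (eq_bigr (fun=> (i == c)%:R)) => [|a _]; last by rewrite eqxx mulr1.
      by rewrite sumr_const card_ord eq_sym mulr_natl.
    have -> : \sum_a jm c a * jm i a = (c == i)%:R.
      transitivity ((jm *m jm^T) c i).
        by rewrite [RHS]mxE; apply: eq_bigr => a _; rewrite [X in _ = _ * X]mxE.
      by rewrite trJ mulmxN JJ opprK mxE.
    by rewrite -natr1 mulrDl mul1r.
  by ring.
by rewrite sum_delta.
Qed.

Lemma column_formE p alpha X : column_form p alpha X = coef p (lshift n alpha) X.
Proof.
rewrite /column_form /coef mxE big_split_ord big_split /=.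
by congr (_ + _); apply: eq_bigr => j _; rewrite !mxE.
Qed.

Lemma J_lshift (i j : 'I_n) : jm (lshift n i) (lshift n j) = 0.
Proof. by rewrite /J block_mxEul mxE. Qed.

Lemma open_nonvanishing q i : open_along_curves (nonvanishing (coef q i)).
Proof.
split=> [X []|X V c [SX qX] cV] //.
have [Sc c0 dc] := cV.
have := mderivMl q^T (dc : mderiv c V) 0 i => /cderiv_near_neq0.
by rewrite c0 => /(_ qX); apply: filterS => t.
Qed.

End SecondOrder.

(** * Non-vanishing of a two by two minor *)

Section Nonvanishing.
Context {R : realType} {n : nat}.
Local Notation C := (R[i]).
Local Notation M := 'M[C]_(n + n).
Local Notation cj := (map_mx Num.conj).
Implicit Types (X : M) (p q : 'cV[C]_(n + n)) (z w : 'M[C]_n).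

Lemma Sp_real z w : cj z = z -> cj w = w ->
  z *m z^T + w *m w^T = 1%:M -> z *m w^T = w *m z^T -> Sp (quat_rep z w).
Proof.
move=> rz rw zw1 zw0; apply/SpP; split; last by apply/quat_repP; exists z, w.
rewrite /quat_rep /conjm rz rw tr_block_mx map_block_mx mulmx_block.
rewrite -!map_trmx conjmxN rz rw linearN /=.
rewrite !mulNmx !mulmxN opprK zw1 zw0 subrr (addrC (w *m _)) zw1.
by rewrite -scalar_mx_block.
Qed.

Lemma coef_quat_lshift p X z w l :
  coef p (lshift n l) (X *m quat_rep z w) =
  \sum_a coef p (lshift n a) X * z a l + \sum_a coef p (rshift n a) X * w a l.
Proof.
rewrite /coef mulmxA mxE big_split_ord /=.
by congr (_ + _); apply: eq_bigr => a _; rewrite ?block_mxEul ?block_mxEdl.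
Qed.

Lemma coef_real_rshift p X z l : cj z = z ->
  coef p (rshift n l) (X *m quat_rep z 0) = \sum_a coef p (rshift n a) X * z a l.
Proof.
move=> rz; rewrite /coef mulmxA mxE big_split_ord /= big1 ?add0r => [|a _].
  by apply: eq_bigr => a _; rewrite block_mxEdr /conjm rz.
by rewrite block_mxEur /conjm map_mx0 oppr0 [X in _ * X]mxE mulr0.
Qed.

Definition minor p q X k l : C :=
  coef p k X * coef q l X - coef p l X * coef q k X.

(** If q_l is nonzero and all minors with the column l vanish, then p is
    p_l / q_l times q. *)
Lemma free_minor p q : free [:: p; q] -> exists k l, minor p q 1%:M k l != 0.
Proof.
rewrite free_cons seq1_free span_seq1 => /andP[pq q0].
have c1 r k : coef r k 1%:M = r k 0 by rewrite /coef mulmx1 mxE.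
have [l ql] : exists l, q l 0 != 0.
  apply/existsP; apply: contraNT q0; rewrite negb_exists => /forallP q0.
  by apply/eqP/matrixP => i j; rewrite ord1 mxE; apply/eqP/negPn/q0.
suff /existsP[k kl] : [exists k, minor p q 1%:M k l != 0] by exists k, l.
apply: contraNT pq; rewrite negb_exists => /forallP kl.
apply/vlineP; exists (p l 0 / q l 0); apply/matrixP => k j; rewrite ord1 mxE.
have := kl k; rewrite negbK /minor !c1 subr_eq0 => /eqP e.
by rewrite mulrAC -e mulfK.
Qed.

Definition side (b : bool) (k : 'I_n) : 'I_(n + n) :=
  if b then rshift n k else lshift n k.

Lemma ex_perm2 (k l i j : 'I_n) : k != l -> i != j ->
  exists s : 'S_n, s i = k /\ s j = l.
Proof.
move=> kl ij; exists (tperm i k * tperm (tperm i k j) l)%g.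
have jk : tperm i k j != k.
  rewrite -[X in _ != X](tpermL i k) inj_eq 1?eq_sym //; exact: perm_inj.
have lk : l != k by rewrite eq_sym.
by rewrite !permM (tpermL i) (tpermL _ l) (tpermD jk lk).
Qed.

Section Fixed.
Variables (p q : 'cV[C]_(n + n)) (i j : 'I_n).
Hypothesis ij : i != j.

Let nonvanishing_point := exists X, [/\ Sp X, coef q (lshift n j) X != 0 &
  minor p q X (lshift n j) (lshift n i) != 0].

(** A permutation matrix moves the columns k and l to j and i. *)
Lemma good_pair X k l : Sp X -> k != l -> coef q (lshift n k) X != 0 ->
  minor p q X (lshift n k) (lshift n l) != 0 -> nonvanishing_point.
Proof.
move=> SX kl qk m; have [|s [sk sl]] := @ex_perm2 j i k l _ kl.
  by rewrite eq_sym.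
have cE r a : coef r (lshift n (s a)) (X *m quat_rep (perm_mx s) 0) =
    coef r (lshift n a) X.
  rewrite coef_quat_lshift [X in _ + X]big1 ?addr0 => [|b _]; last by rewrite mxE mulr0.
  rewrite -[RHS](sum_delta (fun b => coef r (lshift n b) X)).
  by apply: eq_bigr => b _; rewrite !mxE (inj_eq perm_inj).
exists (X *m quat_rep (perm_mx s) 0); rewrite /minor -sk -sl !cE; split=> //.
apply: SpM => //; apply: Sp_real; rewrite ?map_mx0 ?map_perm_mx //.
  by rewrite mul0mx addr0 tr_perm_mx -perm_mxM mulgV perm_mx1.
by rewrite mul0mx trmx0 mulmx0.
Qed.

(** If the coefficient of q vanishes at the column k, it does not at l, and the
    two columns can be exchanged. *)
Lemma good_lshift X k l : Sp X -> k != l ->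
  minor p q X (lshift n k) (lshift n l) != 0 -> nonvanishing_point.
Proof.
move=> SX kl m; have [qk|] := eqVneq (coef q (lshift n k) X) 0; last first.
  by move=> qk; exact: good_pair m.
apply: (@good_pair X l k) => //; first by rewrite eq_sym.
  by move: m; apply: contraNneq => ql; rewrite /minor qk ql !mulr0 subrr.
by move: m; rewrite -oppr_eq0 /minor opprB.
Qed.

(** Multiplication by the quaternion j in the coordinates where [f] holds moves
    columns of the right half to the left half. *)
Lemma good_side X b c k l : Sp X -> k != l ->
  minor p q X (side b k) (side c l) != 0 -> nonvanishing_point.
Proof.
move=> SX kl m.
pose f (a : 'I_n) := if a == k then b else c.
pose z : 'M[C]_n := diag_mx (\row_a (~~ f a)%:R).
pose w : 'M[C]_n := diag_mx (\row_a (f a)%:R).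
have cE r a : coef r (lshift n a) (X *m quat_rep z w) = coef r (side (f a) a) X.
  rewrite coef_quat_lshift /side.
  have zE b0 : z b0 a = (~~ f b0)%:R * (b0 == a)%:R by rewrite !mxE mulr_natr.
  have wE b0 : w b0 a = (f b0)%:R * (b0 == a)%:R by rewrite !mxE mulr_natr.
  under eq_bigr do rewrite zE mulrA.
  under [X in _ + X]eq_bigr do rewrite wE mulrA.
  rewrite (sum_delta (fun b0 => coef r (lshift n b0) X * (~~ f b0)%:R)).
  rewrite (sum_delta (fun b0 => coef r (rshift n b0) X * (f b0)%:R)).
  by case: (f a); rewrite /= ?mulr0 ?mulr1 ?addr0 ?add0r.
apply: (@good_lshift (X *m quat_rep z w) k l) => //; last first.
  by rewrite /minor !cE /f eqxx (eq_sym l) (negbTE kl).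
apply: SpM => //; apply: Sp_real.
- by rewrite map_diag_mx; congr diag_mx; apply/rowP => a; rewrite !mxE rmorph_nat.
- by rewrite map_diag_mx; congr diag_mx; apply/rowP => a; rewrite !mxE rmorph_nat.
- rewrite !tr_diag_mx !mulmx_diag -linearD -diag_const_mx /=; congr diag_mx.
  apply/rowP => a; rewrite !mxE.
  by case: (f a); rewrite /= ?(mulr0, mulr1, addr0, add0r).
- by rewrite !tr_diag_mx !mulmx_diag; congr diag_mx; apply/rowP => a; rewrite !mxE mulrC.
Qed.

(** The real reflection in the hyperplane orthogonal to e_k + 2 e_m.  It has
    rational entries and genuinely mixes the coordinates k and m, whereas the
    reflection for e_k + e_m would only exchange them up to sign. *)
Definition reflection (k m : 'I_n) : 'M[C]_n :=
  let u : 'cV[C]_n := delta_mx k 0 + 2%:R *: delta_mx m 0 in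
  1%:M - (2%:R / 5%:R) *: (u *m u^T).

Lemma reflectionE k m a l : reflection k m a l = (a == l)%:R -
  (2%:R / 5%:R) * (((a == k)%:R + 2%:R * (a == m)%:R) *
                   ((l == k)%:R + 2%:R * (l == m)%:R)).
Proof. by rewrite /reflection !mxE big_ord1 !mxE !andbT. Qed.

Lemma reflection_real k m : cj (reflection k m) = reflection k m.
Proof.
apply/matrixP => a l; rewrite mxE reflectionE.
by rewrite !(rmorph_nat, rmorphB, rmorphM, rmorphD, fmorphV).
Qed.

Lemma reflection_sum (x : 'I_n -> C) k m l :
  \sum_a x a * reflection k m a l = x l -
  (2%:R / 5%:R) * (x k + 2%:R * x m) * ((l == k)%:R + 2%:R * (l == m)%:R).
Proof.
set u := _ + _ * (l == m)%:R.
transitivity (\sum_a (x a * (a == l)%:R - (2%:R / 5%:R * u) * (x a * (a == k)%:R)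
   - (2%:R / 5%:R * u * 2%:R) * (x a * (a == m)%:R))).
  by apply: eq_bigr => a _; rewrite reflectionE -/u; ring.
rewrite !sumrB -!mulr_sumr !sum_delta; ring.
Qed.

Lemma Sp_reflection k m : k != m -> Sp (quat_rep (reflection k m) 0).
Proof.
move=> km; apply: Sp_real; rewrite ?reflection_real ?map_mx0 //; last first.
  by rewrite mul0mx trmx0 mulmx0.
rewrite mul0mx addr0; apply/matrixP => a l; rewrite mxE.
transitivity (\sum_b reflection k m a b * reflection k m b l).
  apply: eq_bigr => b _; rewrite [X in _ * X = _]mxE; congr (_ * _).
  by rewrite !reflectionE (eq_sym l b); ring.
rewrite reflection_sum !reflectionE !mxE !eqxx (negbTE km) (eq_sym m) (negbTE km).
by rewrite /= mulr1n mulr0n; field.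
Qed.

(** Start from a nonzero minor of p and q.  If its two columns lie in one
    quaternionic coordinate l, take another coordinate m.  Unless [good_side]
    already applies, all minors that mix l and m vanish; then the Plucker
    relation forces the minor of m to vanish as well, and a reflection that
    mixes the coordinates turns the minor of l into a nonzero mixed one. *)
Lemma minor_nonvanishing : free [:: p; q] -> nonvanishing_point.
Proof.
move=> /free_minor[k0 [l0]].
have S1 : Sp (1%:M : M).
  apply/SpP; split; first by rewrite trmx1 map_mx1 mulmx1.
  by rewrite map_mx1 mul1mx mulmx1.
have sideP (a : 'I_(n + n)) : exists b k, a = side b k.
  case: (split_ordP a) => [k ->|k ->]; first by exists false, k.
  by exists true, k.
have [b [k ->]] := sideP k0; have [c [l ->]] := sideP l0.
have [->|kl] := eqVneq k l; last exact: good_side.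
have [m lm] : exists m, l != m.
  have [->|li] := eqVneq l i; first by exists j.
  by exists i.
have main : minor p q 1%:M (lshift n l) (rshift n l) != 0 -> nonvanishing_point.
  move=> mll.
  pose X := (1%:M : M) *m quat_rep (reflection l m) 0.
  have SX : Sp X by apply: SpM => //; exact: Sp_reflection.
  have [e1|] := eqVneq (minor p q 1%:M (lshift n l) (lshift n m)) 0; last first.
    by move=> h; apply: (@good_side 1%:M false false l m).
  have [e2|] := eqVneq (minor p q 1%:M (lshift n l) (rshift n m)) 0; last first.
    by move=> h; apply: (@good_side 1%:M false true l m).
  have [e3|] := eqVneq (minor p q 1%:M (rshift n l) (lshift n m)) 0; last first.
    by move=> h; apply: (@good_side 1%:M true false l m).
  have [e4|] := eqVneq (minor p q 1%:M (rshift n l) (rshift n m)) 0; last first.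
    by move=> h; apply: (@good_side 1%:M true true l m).
  (* The Plucker relation, all of whose other terms vanish. *)
  have e5 : minor p q 1%:M (lshift n m) (rshift n m) = 0.
    apply: (mulIf mll); rewrite mul0r.
    transitivity (
       minor p q 1%:M (lshift n l) (lshift n m) *
       minor p q 1%:M (rshift n l) (rshift n m) -
       minor p q 1%:M (lshift n l) (rshift n m) *
       minor p q 1%:M (rshift n l) (lshift n m)).
      by rewrite /minor; ring.
    by rewrite e1 e2 !mul0r subrr.
  apply: (@good_side X false true l m SX lm).
  suff -> : minor p q X (side false l) (side true m) =
      - (12%:R / 25%:R) * minor p q 1%:M (lshift n l) (rshift n l).
    by rewrite mulf_neq0 // oppr_eq0 mulf_neq0 // ?invr_eq0 pnatr_eq0.
  (* 12/25, 9/25 and 16/25 are products of the entries 3/5, -3/5 and -4/5 of the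
     reflection in the coordinates l and m. *)
  transitivity (- (12%:R / 25%:R) * minor p q 1%:M (lshift n l) (rshift n l)
    - (9%:R / 25%:R) * minor p q 1%:M (lshift n l) (rshift n m)
    - (16%:R / 25%:R) * minor p q 1%:M (rshift n l) (lshift n m)
    + (12%:R / 25%:R) * minor p q 1%:M (lshift n m) (rshift n m)).
    rewrite /minor /X /side !coef_real_rshift ?reflection_real //.
    have zE r : coef r (lshift n l) (1%:M *m quat_rep (reflection l m) 0) =
        \sum_a coef r (lshift n a) 1%:M * reflection l m a l.
      by rewrite coef_quat_lshift [X in _ + X]big1 ?addr0 // => a _; rewrite mxE mulr0.
    rewrite !zE !reflection_sum !eqxx (negbTE lm) (eq_sym m) (negbTE lm).
    by rewrite /= mulr1n mulr0n; field.
  by rewrite e2 e3 e5 !mulr0 !subr0 addr0.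
case: b c => -[] //=; rewrite /side => h.
- by move: h; rewrite /minor subrr eqxx.
- by apply: main; move: h; rewrite -oppr_eq0 /minor opprB.
- by move: h; rewrite /minor subrr eqxx.
Qed.

End Fixed.
End Nonvanishing.

(** * The quotient of two matrix coefficients *)

Section Quotient.
Context {R : realType} {n : nat}.
Local Notation C := (R[i]).
Local Notation M := 'M[C]_(n + n).
Variables (p q : 'cV[C]_(n + n)) (alpha beta : 'I_n).

Let i := lshift n alpha.
Let j := lshift n beta.
Let W : set M := nonvanishing (coef q j).

(** P and Q have the same eigenvalue, so its contributions cancel, and the two
    remaining terms are products of coefficients by [kappa_dcoef]. *)
Lemma tau_quotient X : W X -> tau (fun X => coef p i X / coef q j X) X =
  coef p j X * coef q i X * ((coef q j X)^-1 * (coef q j X)^-1) +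
  (-1) * (coef p i X / coef q j X).
Proof.
move=> WX; have q0 (Y : M) : W Y -> coef q j Y != 0 by case.
rewrite (second_order_tau (open_nonvanishing q j)
  (second_orderM (second_order_coef W p i)
     (second_orderV q0 (second_order_coef W q j))) WX).
rewrite kappaZr !kappa_dcoef ?J_lshift //.
have := q0 X WX; move: (coef q j X) (coef q i X) (coef p i X) (coef p j X).
by move=> c b a d c0; field.
Qed.

(** The first summand P_b Q_a / Q_b^2 of [tau_quotient] is sent to
    P_b Q_a / Q_b^2 - P_a / Q_b as well, so the two summands cancel. *)
Lemma tau_tau_quotient X : W X ->
  tau (tau (fun X => coef p i X / coef q j X)) X = 0.
Proof.
move=> WX; have q0 (Y : M) : W Y -> coef q j Y != 0 by case.
have V := second_orderV q0 (second_order_coef W q j).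
have tauE := fun Y WY => esym (@tau_quotient Y WY).
rewrite (second_order_tau (open_nonvanishing q j)
  (second_order_near (open_nonvanishing q j) tauE
    (second_orderD
      (second_orderM (second_orderM (second_order_coef W p j) (second_order_coef W q i))
         (second_orderM V V))
      (second_orderZ (-1) (second_orderM (second_order_coef W p i) V)))) WX).
rewrite !kappaDr !kappaZr !kappaDl !kappaZl !kappa_dcoef ?J_lshift //.
have := q0 X WX; move: (coef q j X) (coef q i X) (coef p i X) (coef p j X).
by move=> c b a d c0; field.
Qed.

End Quotient.

Theorem theorem6p2 (R : realType) (n : nat) (p q : 'cV[complex R]_(n + n))
    (hpq : free [:: p; q]) (alpha beta : 'I_n) :
  let P : 'M[complex R]_(n + n) -> complex R := column_form p alpha in
  let Q : 'M[complex R]_(n + n) -> complex R := column_form q beta in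
  let f := fun X => P X / Q X in
  let W_Q := nonvanishing Q in
  (harmonic_on W_Q f <-> alpha = beta) /\
  (proper_biharmonic_on W_Q f <-> alpha <> beta).
Proof.
move=> P Q f W_Q.
have PE : P = coef p (lshift n alpha) by apply/funext => X; exact: column_formE.
have QE : Q = coef q (lshift n beta) by apply/funext => X; exact: column_formE.
have harm : alpha = beta -> harmonic_on W_Q f.
  rewrite /W_Q /f PE QE => -> X WX; rewrite tau_quotient //.
  have [_] := WX; move: (coef q _ X) (coef p _ X) => c a c0.
  by field.
have nonzero : alpha <> beta -> exists X, W_Q X /\ tau f X <> 0.
  move=> /eqP /minor_nonvanishing /(_ hpq)[X [SX qX m]].
  rewrite /W_Q /f PE QE; exists X; split=> //; rewrite tau_quotient //.
  move: qX m; rewrite /minor; move: (coef q (lshift n beta) X)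
    (coef q (lshift n alpha) X) (coef p (lshift n alpha) X) (coef p (lshift n beta) X).
  move=> c b a d c0; apply: contra_neq_not => e.
  have -> : d * b - a * c = c ^+ 2 * (d * b * (c^-1 * c^-1) + -1 * (a / c)) by field.
  by rewrite e mulr0.
split; split=> //.
- move=> h; apply/eqP/negP => /negP/eqP/nonzero[X [WX]]; apply; exact: h.
- by move=> [_ [X [WX tX]]] /harm /(_ X WX).
move=> ab; split; last exact: nonzero.
by rewrite /W_Q /f PE QE => X WX; exact: tau_tau_quotient.
Qed.
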